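(* Let $\ell=\ell(n)$ be a sequence of integers with $\ell\ge 2$ and $\ell/n\to 0$ as $n\to\infty$. Then almost all $\ell$-lifts of $K_n$ have Hajós number equal to $(1+o(1))\sqrt{\frac{2n\ell}{1-1/\ell}}$; that is, for every $\delta>0$, if $G$ is a uniformly random $\ell$-lift of $K_n$ and $h(G)$ denotes its Hajós number, then the probability that $$(1-\delta)\sqrt{\frac{2n\ell}{1-1/\ell}}\le h(G)\le (1+\delta)\sqrt{\frac{2n\ell}{1-1/\ell}}$$ tends to $1$ as $n\to\infty$.
   Context: An $\ell$-lift of a graph $H$ is a graph obtained by replacing every vertex $v$ of $H$ by an independent set (the fiber of $v$) of $\ell$ vertices, say $\{v\}\times\{1,\dots,\ell\}$, and placing, for each edge $uv$ of $H$, a perfect matching (of size $\ell$) between the fibers of $u$ and $v$; there are no other edges. A uniformly random $\ell$-lift of $H$ is obtained by choosing, independently for each edge $uv$ of $H$, a uniformly random perfect matching between the fibers of $u$ and $v$. Almost all $\ell$-lifts of $K_n$ satisfy a property if the proportion of $\ell$-lifts of $K_n$ failing it tends to $0$ as $n\to\infty$. A topological clique of order $m$ (equivalently, a subdivision of $K_m$) is a graph consisting of $m$ branch vertices, all pairs of which are joined by pairwise internally vertex-disjoint paths (one path for each pair, whose internal vertices are not branch vertices). The Hajós number of a graph is the largest $m$ such that it contains a topological clique of order $m$ as a subgraph. *)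

(* Defs.v *)
From mathcomp Require Import all_boot all_order all_algebra.
From mathcomp Require Import boolp.

Set Implicit Arguments.
Unset Strict Implicit.
Unset Printing Implicit Defensive.

Import GRing.Theory Num.Theory.

(* A graph on the vertex set T is given by its set of edges E : {set {set T}}. *)

Definition simple_graph (T : finType) (E : {set {set T}}) : bool :=
  [forall e in E, #|e| == 2].

Definition adj (T : finType) (E : {set {set T}}) : rel T :=
  fun x y => [set x; y] \in E.

Definition complete_graph (n : nat) : {set {set 'I_n}} :=
  [set e : {set 'I_n} | #|e| == 2].

Definition fiber (V : finType) (l : nat) (v : V) : {set V * 'I_l} :=
  [set x : V * 'I_l | x.1 == v].

(* For disjoint A and B: the edges of E between A and B form a perfect
   matching of A with B. *)
Definition perfectly_matched (T : finType) (E : {set {set T}}) (A B : {set T}) :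
    bool :=
  [forall x in A, #|[set y in B | adj E x y]| == 1] &&
  [forall y in B, #|[set x in A | adj E x y]| == 1].

Definition is_lift (V : finType) (H : {set {set V}}) (l : nat)
    (G : {set {set V * 'I_l}}) : bool :=
  [&& simple_graph G,
      [forall x, forall y, adj G x y ==> adj H x.1 y.1] &
      [forall u, forall v,
        adj H u v ==> perfectly_matched G (fiber l u) (fiber l v)]].

Definition lifts (V : finType) (H : {set {set V}}) (l : nat) :
    {set {set {set V * 'I_l}}} :=
  [set G | is_lift H G].

(* A lift of H amounts to one perfect matching per edge of H, so independent
   uniform matchings give the uniform distribution on [lifts H l]. *)
Definition lift_prob (R : realFieldType) (V : finType) (H : {set {set V}})
    (l : nat) (P : pred {set {set V * 'I_l}}) : R :=
  (#|[set G in lifts H l | P G]|%:R / #|lifts H l|%:R)%R.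

(* The path joining b i and b j, for i < j, has p i j as its sequence of
   internal vertices; the values p i j with j <= i are irrelevant. *)
Definition has_topological_clique (T : finType) (E : {set {set T}}) (m : nat) :
    Prop :=
  exists (b : 'I_m -> T) (p : 'I_m -> 'I_m -> seq T),
    [/\ injective b,
        forall i j : 'I_m, i < j -> path (adj E) (b i) (rcons (p i j) (b j)),
        forall i j : 'I_m, i < j -> uniq (p i j),
        forall i j k : 'I_m, i < j -> b k \notin p i j &
        forall i j i' j' : 'I_m, i < j -> i' < j' -> (i, j) != (i', j') ->
          forall x : T, x \in p i j -> x \notin p i' j'].

(* The bound #|T| on m loses nothing, see hajos_max. *)
Definition hajos (T : finType) (E : {set {set T}}) : nat :=
  \max_(m < #|T|.+1 | `[< has_topological_clique E m >]) m.

Lemma has_topological_clique_card (T : finType) (E : {set {set T}}) (m : nat) :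
  has_topological_clique E m -> m <= #|T|.
Proof.
move=> [b [_ [b_inj _ _ _ _]]].
by rewrite -[m in m <= _]card_ord; exact: leq_card b_inj.
Qed.

Lemma has_topological_clique0 (T : finType) (E : {set {set T}}) :
  has_topological_clique E 0.
Proof.
have f0 (A : Type) (i : 'I_0) : A by case: i.
by exists (f0 T), (fun i => f0 _ i); split; case.
Qed.

Lemma hajosP (T : finType) (E : {set {set T}}) :
  has_topological_clique E (hajos E).
Proof.
have P0 : `[< has_topological_clique E (@ord0 #|T|) >].
  exact/asboolP/has_topological_clique0.
by rewrite /hajos (bigmax_eq_arg ord0 P0); case: arg_maxnP => // i /asboolP.
Qed.

Lemma hajos_max (T : finType) (E : {set {set T}}) (m : nat) :
  has_topological_clique E m -> m <= hajos E.
Proof.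
move=> Em; have lt_m : m < #|T|.+1 by rewrite ltnS (has_topological_clique_card Em).
by apply: (@leq_bigmax_cond _ _ _ (Ordinal lt_m)); apply/asboolP.
Qed.

Definition hajos_scale (R : rcfType) (n l : nat) : R :=
  Num.sqrt (2 * n%:R * l%:R / (1 - l%:R^-1))%R.

(* Main.v *)
Require Import Defs.
From mathcomp Require Import all_boot all_order all_algebra all_fingroup.
From mathcomp Require Import all_classical all_reals all_analysis.
From mathcomp Require Import fintype finset.
From mathcomp Require Import ring lra zify.

(** In a topological clique of order [m], each pair of
    non-adjacent branch vertices spends at least one internal vertex of its
    own, and there are only [n * l] vertices.  A random lift has edge density
    [1 / l], so about [(1 - 1 / l) * m ^ 2 / 2] pairs of branch vertices are
    non-adjacent, whence [m] is at most about
    [sqrt (2 * n * l / (1 - 1 / l))].  Conversely this count is the only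
    obstruction, because almost every non-adjacent pair can be joined through a
    single vertex.

    A uniform lift is the image of a family of independent uniform permutations,
    one for each pair of fibers ([lift_probE]).  Every probabilistic argument is
    thus a finite average over a product space, and independence is used in
    the form of resampling: redrawing the coordinates in a set [J] and keeping the
    others does not change an average ([mean_resample]).

    Upper tail ([upper_tail]).  A union bound runs over the sets [S] of [m]
    vertices.  A fixed [S] with an unusually large number of inner edges has
    probability [exp (- c * m ^ 2)], which beats the [(n * l) ^ m] choices of
    [S].  The exponential moment behind this is no larger than for independent
    edges ([edges_in_mgf]), since the edges of a random perfect matching are
    negatively correlated ([perm_mgf]).

    Lower tail ([lower_tail]).  The branch vertices are all the vertices of [k]
    whole fibers, with [k] slightly below [sqrt (2 * n / (l - 1))].  Taking whole
    fibers makes the count exact: there are [k ^ 2 * l * (l - 1) / 2] non-adjacent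
    pairs.  It also gives any vertex elsewhere exactly one neighbour in each
    branch fiber, so that such a vertex sees a
    uniformly random transversal of the branch fibers.  Most of the other fibers
    serve as connectors.  They are treated one after the other, and each of
    their vertices becomes the middle of a path joining a pair that it sees
    and that is not joined yet.  As long as a positive proportion [mu] of the pairs
    remains, a second moment computation shows that a transversal misses all of
    them with probability of order [1 / k] ([prob_no_seen_pair]), so almost no
    vertex of a connector fiber is wasted ([mean_idle_total]) and fewer than [n]
    fibers are enough to leave at most [2 * mu * (k * l) ^ 2] pairs.

    The few branch vertices lying in many leftover pairs are given up.  The
    other leftover pairs are joined by paths with two internal vertices taken
    from reserved fibers.  Each branch fiber has [2 * r] reserved fibers of its
    own, so a reserved vertex is the neighbour of a single vertex of the branch
    fiber that owns it and different branch vertices never compete.  Since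
    [r / l] is large, with high probability any half of the left reserved
    neighbours of [x] is joined by an edge to any half of the right reserved
    neighbours of [y], for all [x] and [y] at once ([prob_not_well_linked]), and
    then all leftover pairs can be linked greedily ([disjoint_links]).

    Both tails are small as soon as [n / l] exceeds a constant, which is how the
    hypothesis that [l / n] tends to [0] enters. *)

Set Implicit Arguments.
Unset Strict Implicit.
Unset Printing Implicit Defensive.

Import Order.TTheory GRing.Theory Num.Theory.
Import numFieldNormedType.Exports.
Local Open Scope ring_scope.

(** * Expectations over finite probability spaces *)

Section Mean.
Variables (R : realFieldType) (T : finType).
Implicit Types (h g : T -> R) (P Q : pred T).

Definition mean h : R := (\sum_t h t) / #|T|%:R.
Definition prob P : R := mean (fun t => (P t)%:R).

Lemma eq_mean h g : h =1 g -> mean h = mean g.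
Proof. by move=> hg; rewrite /mean (eq_bigr g). Qed.

Lemma eq_prob P Q : P =1 Q -> prob P = prob Q.
Proof. by move=> PQ; apply: eq_mean => t; rewrite PQ. Qed.

Lemma le_mean h g : (forall t, h t <= g t) -> mean h <= mean g.
Proof.
by move=> hg; rewrite ler_wpM2r ?invr_ge0 ?ler0n //; apply: ler_sum.
Qed.

Lemma mean_ge0 h : (forall t, 0 <= h t) -> 0 <= mean h.
Proof. by move=> h0; rewrite divr_ge0 ?ler0n // sumr_ge0. Qed.

Lemma meanD h g : mean (fun t => h t + g t) = mean h + mean g.
Proof. by rewrite /mean big_split mulrDl. Qed.

Lemma meanZl c h : mean (fun t => c * h t) = c * mean h.
Proof. by rewrite /mean -mulr_sumr mulrA. Qed.

Lemma meanZr c h : mean (fun t => h t * c) = mean h * c.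
Proof. by rewrite mulrC -meanZl; apply: eq_mean => t; rewrite mulrC. Qed.

Lemma mean_sum (I : Type) (r : seq I) (P : pred I) (h : I -> T -> R) :
  mean (fun t => \sum_(i <- r | P i) h i t) = \sum_(i <- r | P i) mean (h i).
Proof. by rewrite /mean exchange_big /= mulr_suml. Qed.

Lemma mean_cst (c : R) : (0 < #|T|)%N -> mean (fun=> c) = c.
Proof.
by move=> T0; rewrite /mean sumr_const -[c *+ _]mulr_natr mulfK // pnatr_eq0 -lt0n.
Qed.

Lemma prob_ge0 P : 0 <= prob P.
Proof. by apply: mean_ge0 => t; rewrite ler0n. Qed.

Lemma le_prob P Q : (forall t, P t -> Q t) -> prob P <= prob Q.
Proof.
by move=> PQ; apply: le_mean => t; rewrite ler_nat; case: (P t) (PQ t) => // ->.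
Qed.

Lemma probE P : prob P = #|P|%:R / #|T|%:R.
Proof. by rewrite /prob /mean -natr_sum -big_mkcond sum1_card. Qed.

Lemma probC P : (0 < #|T|)%N -> prob P = 1 - prob (predC P).
Proof.
move=> T0; rewrite -(mean_cst 1 T0); apply/eqP.
rewrite eq_sym subr_eq /prob -meanD; apply/eqP/eq_mean => t /=.
by case: (P t); rewrite /= ?addr0 ?add0r.
Qed.

Lemma probU P Q : prob (predU P Q) <= prob P + prob Q.
Proof.
rewrite -meanD; apply: le_mean => t /=; rewrite -natrD ler_nat.
by case: (P t); case: (Q t).
Qed.

Lemma prob_exists (I : finType) (S : pred I) (P : I -> pred T) :
  prob (fun t => [exists i in S, P i t]) <= \sum_(i in S) prob (P i).
Proof.
rewrite /prob -mean_sum; apply: le_mean => t.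
case: existsP => [[i /andP[Si Pi]]|_]; last by rewrite sumr_ge0.
by rewrite (bigD1 i) //= Pi lerDl sumr_ge0.
Qed.

Lemma mean_markov h P c : 0 < c -> (forall t, 0 <= h t) ->
  (forall t, P t -> c <= h t) -> prob P <= mean h / c.
Proof.
move=> c0 h0 Ph; rewrite ler_pdivlMr // -meanZr; apply: le_mean => t.
by case: (boolP (P t)) => [/Ph|_]; rewrite ?mul1r // mul0r.
Qed.

End Mean.

Section Reindex.
Variables (R : realFieldType).

Lemma mean_bij (T : finType) (f : T -> T) (h : T -> R) :
  injective f -> mean (fun t => h (f t)) = mean h.
Proof. by move=> fI; rewrite /mean [in RHS](reindex_inj fI). Qed.

(** A random element all of whose point probabilities agree is uniform; this turns a symmetry of the probability space into an exact probability. *)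
Lemma prob_equidistributed (T A : finType) (X : T -> A) (S : {set A}) :
  (0 < #|T|)%N -> (forall a b, prob R (fun t => X t == a) = prob R (fun t => X t == b)) ->
  prob R (fun t => X t \in S) = #|S|%:R / #|A|%:R.
Proof.
move=> T0 eqX.
have sumS (U : {set A}) :
    prob R (fun t => X t \in U) = \sum_(a in U) prob R (fun t => X t == a).
  rewrite /prob -mean_sum; apply: eq_mean => t; rewrite -natr_sum; congr _%:R.
  case: (boolP (X t \in U)) => [XU|XU].
    by rewrite (bigD1 (X t)) //= eqxx big1 // => a /andP[_]; rewrite eq_sym => /negPf->.
  by rewrite big1 // => a aU; case: eqP => // Xa; rewrite Xa aU in XU.
have [A0|/card_gt0P [a _]] := posnP #|A|.
  by case/card_gt0P: T0 => t _; have := card0_eq A0 (X t).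
have eqa (U : {set A}) : prob R (fun t => X t \in U) = #|U|%:R * prob R (fun t => X t == a).
  by rewrite sumS (eq_bigr _ (fun b _ => eqX b a)) sumr_const mulr_natl.
have /eqP := eqa [set: A]; rewrite {1}/prob (eq_mean (g := fun=> 1)); last first.
  by move=> t; rewrite inE.
rewrite mean_cst // cardsT => /eqP e1; rewrite eqa.
have A0 : #|A|%:R != 0 :> R.
  by apply: contra_eq_neq e1 => ->; rewrite mul0r oner_neq0.
by congr (_ * _); apply: (mulfI A0); rewrite -e1 divff.
Qed.

End Reindex.

Section ProductSpace.
Variables (R : realFieldType) (I A : finType).
Local Notation Omega := {ffun I -> A}.
Implicit Types (J : {set I}) (s t : Omega) (h g : Omega -> R).

Definition resample J t s : Omega := [ffun p => if p \in J then t p else s p].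

(** The finite counterpart of measurability with respect to the coordinates in [J]. *)
Definition depends_on (B : Type) J (h : Omega -> B) :=
  forall s t, {in J, s =1 t} -> h s = h t.

Lemma resample_in J t s p : p \in J -> resample J t s p = t p.
Proof. by move=> pJ; rewrite ffunE pJ. Qed.

Lemma resample_notin J t s p : p \notin J -> resample J t s p = s p.
Proof. by move=> pJ; rewrite ffunE (negPf pJ). Qed.

(** The map sending [(s, t)] to [(resample J t s, resample J s t)] exchanges the [J]-coordinates of the two families.  It is an involution, hence preserves the average over pairs.  This plays the role of Fubini: with [s] frozen, only the coordinates in [J] are random. *)
Lemma mean_resample J h : mean (fun s => mean (fun t => h (resample J t s))) = mean h.
Proof.
have [om0|om0] := posnP #|{: Omega}|.
  by rewrite /mean om0 invr0 !mulr0.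
pose f (st : Omega * Omega) := (resample J st.2 st.1, resample J st.1 st.2).
have fK : involutive f.
  move=> [s t]; congr (_, _); apply/ffunP => p; rewrite !ffunE /=;
    by case: (p \in J).
rewrite /mean -mulr_suml pair_big /= (reindex_inj (inv_inj fK)) /=.
rewrite (eq_bigr (fun p => h p.1)) => [|[s t] _ /=]; last first.
  by congr (h _); apply/ffunP => p; rewrite !ffunE; case: ifP; rewrite ?ffunE => ->.
rewrite -(pair_big xpredT xpredT (fun s _ => h s)) /= mulr_suml.
congr (_ / _); apply: eq_bigr => s _; rewrite sumr_const.
by rewrite -[h s *+ _]mulr_natr mulfK // pnatr_eq0 -lt0n.
Qed.

Lemma le_mean_resample J h c : (0 < #|{: Omega}|)%N ->
  (forall s, mean (fun t => h (resample J t s)) <= c) -> mean h <= c.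
Proof.
by move=> om0 hc; rewrite -(mean_resample J) -(mean_cst c om0); apply: le_mean.
Qed.

(** After resampling [J], the first factor sees only the new family and the second one only the old family. *)
Lemma mean_indep J h g : depends_on J h -> depends_on (~: J) g ->
  mean (fun s => h s * g s) = mean h * mean g.
Proof.
move=> hJ gJ; rewrite -(mean_resample J) -[in RHS]meanZl; apply: eq_mean => s.
rewrite -meanZr; apply: eq_mean => t; congr (_ * _).
  by apply: hJ => p pJ; rewrite resample_in.
by apply: gJ => p; rewrite inE => pJ; rewrite resample_notin.
Qed.

Lemma mean_coord (p : I) (g : A -> R) : (0 < #|A|)%N ->
  mean (fun s : Omega => g (s p)) = mean g.
Proof.
move=> A0; have A0R : #|A|%:R != 0 :> R by rewrite pnatr_eq0 -lt0n.
pose G q a : R := if q == p then g a else 1.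
rewrite /mean (eq_bigr (fun s : Omega => \prod_q G q (s q))) => [|s _]; last first.
  by rewrite (bigD1 p) //= {1}/G eqxx big1 ?mulr1 // => q /negPf qp; rewrite /G qp.
rewrite -bigA_distr_bigA (bigD1 p) //= {1}/G eqxx -mulrA; congr (_ * _).
rewrite (eq_bigr (fun=> #|A|%:R)) => [|q /negPf qp]; last first.
  by rewrite /G qp sumr_const.
rewrite card_ffun natrX -[#|I|]/#|xpredT| -prodr_const [X in _ / X](bigD1 p) //=.
by rewrite invfM mulrCA divff ?mulr1 // prodf_seq_neq0; apply/allP => q _; rewrite A0R implybT.
Qed.

Lemma card_Omega_gt0 : (0 < #|A|)%N -> (0 < #|{: Omega}|)%N.
Proof. by move=> A0; rewrite card_ffun expn_gt0 A0. Qed.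

(** Iterated independence: factors read at distinct coordinates average separately. *)
Lemma mean_prod (C : eqType) (r : seq C) (key : C -> I) (h : C -> A -> R) :
  (0 < #|A|)%N -> uniq r -> {in r &, injective key} ->
  mean (fun s : Omega => \prod_(c <- r) h c (s (key c))) =
  \prod_(c <- r) mean (h c).
Proof.
move=> A0; elim: r => [_ _|c r IH /= /andP[cr ur] keyI].
  by rewrite big_nil (eq_mean (g := fun=> 1)) ?mean_cst ?card_Omega_gt0 // => s; rewrite big_nil.
under eq_mean do rewrite big_cons.
rewrite big_cons -(mean_coord (key c)) // -IH //; last first.
  by move=> x y xr yr; apply: keyI; rewrite inE ?xr ?yr orbT.
apply: (mean_indep (J := [set key c])) => [s t st|s t st].
  by rewrite st ?inE.
apply: eq_big_seq => d dr; rewrite st // !inE; apply: contraNneq cr => /keyI <- //;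
  by rewrite !inE ?eqxx ?dr ?orbT.
Qed.

End ProductSpace.

(** * Lifts as families of permutations *)

Section LiftModel.
Variables (n l : nat).
Local Notation V := 'I_n.
Local Notation T := (V * 'I_l)%type.

Local Notation matchings := {ffun V * V -> {perm 'I_l}}.

Implicit Types (s : matchings) (u v : V) (x y : T).

(** The matching between the fibers of [u] and [v] is stored at the coordinate [(u, v)] with [u < v] and read backwards from [v] to [u].  Indexing by all ordered pairs makes the sample space a plain power. *)
Definition partner s u v : {perm 'I_l} :=
  if (u < v)%N then s (u, v) else ((s (v, u))^-1)%g.

Definition lift_adj s : rel T :=
  fun x y => (x.1 != y.1) && (partner s x.1 y.1 x.2 == y.2).

Definition lift_of s : {set {set T}} :=
  [set [set p.1; p.2] | p : T * T in [pred p | lift_adj s p.1 p.2]].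

Lemma partnerV s u v : u != v -> partner s v u = ((partner s u v)^-1)%g.
Proof.
by rewrite /partner -val_eqE /=; case: (ssrnat.ltngtP u v) => //= _ _; rewrite invgK.
Qed.

Lemma lift_adj_sym s : symmetric (lift_adj s).
Proof.
move=> x y; rewrite /lift_adj eq_sym; case: eqVneq => //= yx.
by rewrite (partnerV _ yx) (can2_eq (permKV _) (permK _)) [in RHS]eq_sym.
Qed.

Lemma adj_lift_of s x y : adj (lift_of s) x y = lift_adj s x y.
Proof.
apply/imsetP/idP => [[[a b]]|xy]; last by exists (x, y).
rewrite inE /= => ab e.
have xin : x \in [set a; b] by rewrite -e set21.
have yin : y \in [set a; b] by rewrite -e set22.
have nab : a != b by apply: contraTneq ab => ->; rewrite /lift_adj eqxx.
have nxy : x != y.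
  have := cards2 x y; rewrite e cards2 nab; by case: eqVneq.
case/set2P: xin nxy => ->; case/set2P: yin => ->; rewrite ?eqxx // => _.
by rewrite lift_adj_sym.
Qed.

Lemma lift_of_inP s e :
  reflect (exists2 p : T * T, lift_adj s p.1 p.2 & e = [set p.1; p.2]) (e \in lift_of s).
Proof. by apply: (iffP imsetP) => -[p]; exists p. Qed.

Lemma lift_of_lift s : is_lift (complete_graph n) (lift_of s).
Proof.
apply/and3P; split.
- apply/forall_inP => e /lift_of_inP[[x y] /= xy ->].
  have nxy : x != y by apply: contraTneq xy => ->; rewrite /lift_adj eqxx.
  by rewrite cards2 nxy.
- apply/forallP => x; apply/forallP => y; rewrite adj_lift_of.
  by apply/implyP => /andP[xy _]; rewrite /adj inE cards2 xy.
- apply/forallP => u; apply/forallP => v; apply/implyP.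
  rewrite /adj inE cards2; case: (eqVneq u v) => //= uv _.
  apply/andP; split; apply/forall_inP => x; rewrite inE => /eqP ux.
    apply/cards1P; exists (v, partner s u v x.2); apply/setP => y.
    rewrite !inE adj_lift_of /lift_adj ux -pair_eqE /= /pair_eq /=.
    by case: eqVneq => //= ->; rewrite uv eq_sym.
  apply/cards1P; exists (u, partner s v u x.2); apply/setP => y.
  rewrite !inE adj_lift_of lift_adj_sym /lift_adj ux -pair_eqE /= /pair_eq /=.
  by case: eqVneq => //= ->; rewrite eq_sym uv eq_sym.
Qed.

(** A perfect matching between two fibers is a function in each direction, and the two are inverse to each other. *)
Lemma lift_of_surj (G : {set {set T}}) :
  G \in lifts (complete_graph n) l -> exists s, lift_of s = G.
Proof.
rewrite inE => /and3P[/forall_inP Gs /forallP Ga /forallP Gm].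
have match1 u v i : exists j, if u == v then j == i else [forall j', adj G (u, i) (v, j') == (j' == j)].
  case: (eqVneq u v) => [_|uv]; first by exists i.
  have /forallP/(_ v) := Gm u.
  rewrite {1}/adj inE cards2 uv /= => /andP[/forall_inP/(_ (u, i)) + _].
  rewrite inE eqxx => /(_ isT)/cards1P[[w j] /setP Hw]; exists j.
  have := Hw (w, j); rewrite !inE eqxx /= => /andP[/eqP wv _].
  apply/forallP => j'; have := Hw (v, j'); rewrite !inE eqxx /= => ->.
  by rewrite -pair_eqE /= /pair_eq wv eqxx.
have [f fP] : exists f : V -> V -> 'I_l -> 'I_l, forall u v i,
    if u == v then f u v i == i
    else [forall j', adj G (u, i) (v, j') == (j' == f u v i)].
  by exists (fun u v i => xchoose (match1 u v i)) => u v i; exact: (xchooseP (match1 u v i)).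
have fE u v i j : u != v -> adj G (u, i) (v, j) = (j == f u v i).
  move=> uv; have := fP u v i.
  by rewrite (negPf uv) => /forallP/(_ j)/eqP.
have adjC x y : adj G x y = adj G y x by rewrite /adj finset.setUC.
have fI u v : injective (f u v).
  move=> i i' e; case: (eqVneq u v) => [uv|uv].
    by have := fP u v i; have := fP u v i'; rewrite e uv eqxx => /eqP Hi' /eqP <-.
  have fVK i0 : f v u (f u v i0) = i0.
    have := fE u v i0 (f u v i0) uv; rewrite eqxx adjC fE 1?eq_sym //.
    by move=> /eqP.
  by rewrite -[i]fVK e fVK.
exists [ffun p : V * V => perm (@fI p.1 p.2)].
set s := finfun _.
have adjE x y : lift_adj s x y = adj G x y.
  wlog lt : x y / (x.1 < y.1)%N => [W|].
    case: (ssrnat.ltngtP x.1 y.1) => [/W//|/W|/val_inj xy].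
      by rewrite lift_adj_sym adjC.
    rewrite /lift_adj xy eqxx /=; apply/esym/negbTE/negP => Gxy.
    have := Ga x; move=> /forallP/(_ y); rewrite Gxy /= /adj xy inE cards2 eqxx //.
  have ne : x.1 != y.1 by rewrite -val_eqE neq_ltn lt.
  case: x y lt ne => [u i] [v j] /= lt ne.
  by rewrite /lift_adj /= /partner lt ffunE permE fE // ne eq_sym.
apply/setP => e; apply/idP/idP.
  by move=> /lift_of_inP [[x y] xy ->]; move: xy; rewrite adjE.
move=> eG; have /cards2P[x [y [_ e2]]] := Gs e eG.
by rewrite e2 -[_ \in _]/(adj _ _ _) adj_lift_of adjE /adj -e2.
Qed.

(** All the fibers of [lift_of] therefore have the same size: the coordinates [(u, v)] with [u < v] are determined and the others are free. *)
Lemma lift_of_eq s t :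
  (lift_of s == lift_of t) = (s \in family (fun p : V * V =>
     if (p.1 < p.2)%N then pred1 (t p) else predT)).
Proof.
apply/eqP/familyP => [e [u v]|fam].
  case: ifP => //= uv; rewrite inE; apply/eqP/permP => i.
  have ne : u != v by rewrite -val_eqE neq_ltn uv.
  have := adj_lift_of s (u, i) (v, s (u, v) i).
  rewrite e adj_lift_of /lift_adj /= /partner uv eqxx ne => /eqP; by [].
have st (p : V * V) : (p.1 < p.2)%N -> s p = t p.
  by move=> lt; have := fam p; rewrite lt inE => /eqP.
have adjE x y : lift_adj s x y = lift_adj t x y.
  rewrite /lift_adj /partner -val_eqE /=.
  by case: (ssrnat.ltngtP x.1 y.1) => //= lt; rewrite st.
by apply/setP => e; apply/lift_of_inP/lift_of_inP => -[p xy ->]; exists p;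
  rewrite // ?adjE // -adjE.
Qed.

(** [lift_of] is onto the lifts with fibers of constant size, so it carries the uniform distribution to the uniform distribution. *)
Lemma lift_probE (R : realFieldType) (P : pred {set {set T}}) :
  lift_prob R (complete_graph n) P = prob R (fun s => P (lift_of s)).
Proof.
pose c := #|family (fun p : V * V =>
   if (p.1 < p.2)%N then pred1 (1%g : {perm 'I_l}) else predT)|.
have cE t : #|[pred s | lift_of s == lift_of t]| = c.
  rewrite (eq_card (B := family (fun p : V * V =>
     if (p.1 < p.2)%N then pred1 (t p) else predT))); last first.
    by move=> s; rewrite inE lift_of_eq.
  rewrite /c !card_family; congr foldr; apply: eq_map => p.
  by case: ifP => // _; rewrite !card1.
have c0 : (0 < c)%N.
  by rewrite -(cE [ffun=> 1%g]); apply/card_gt0P; exists [ffun=> 1%g]; rewrite inE /=.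
have count (Q : pred {set {set T}}) :
    #|[pred s | Q (lift_of s)]| = (#|[set G in lifts (complete_graph n) l | Q G]| * c)%N.
  rewrite -[LHS]sum1_card (partition_big lift_of
    (fun G => G \in [set G in lifts (complete_graph n) l | Q G])) /=; last first.
    by move=> s; rewrite !inE => ->; rewrite lift_of_lift.
  rewrite -sum_nat_const; apply: eq_bigr => G; rewrite inE => /andP[].
  move=> /lift_of_surj[t <-] Qt; rewrite -(cE t) -[RHS]sum1_card; apply: eq_bigl => s.
  by rewrite !inE; case: eqP => [->|]; rewrite ?Qt ?andbF.
rewrite probE count /lift_prob.
have -> : #|{: matchings}| = (#|lifts (complete_graph n) l| * c)%N.
  have := count xpredT; rewrite (eq_card (B := lifts (complete_graph n) l)) => [<-|G].
    by apply: eq_card => s.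
  by rewrite !inE andbT.
rewrite !natrM invfM mulrACA divff ?mulr1 //; by rewrite pnatr_eq0 -lt0n.
Qed.

End LiftModel.

(** * Random permutations *)

Section RandomPerm.
Variables (R : realFieldType) (X : finType).
Implicit Types (A B : {set X}) (s r : seq X).
Local Notation d B := (#|B|%:R / #|X|%:R : R).

Lemma card_perm_gt0 : (0 < #|{: {perm X}}|)%N.
Proof. by apply/card_gt0P; exists 1%g. Qed.

Lemma prob_perm_coord (i j : X) :
  prob R (fun p : {perm X} => p i == j) = #|X|%:R^-1.
Proof.
have := prob_equidistributed (R := R) (X := fun p : {perm X} => p i) [set j] card_perm_gt0.
rewrite cards1 mul1r => <- => [|a b]; first by apply: eq_prob => p; rewrite inE.
rewrite /prob -(mean_bij _ (mulIg (tperm a b))); apply: eq_mean => p.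
by rewrite permM (can2_eq (tpermK _ _) (tpermK _ _)) tpermL.
Qed.

(** Sampling without replacement is dominated by sampling with replacement.  Given that the points of [s] land in [B], a further point has probability [(#|B| - size s) / (#|X| - size s)] of landing in [B], which is at most [#|B| / #|X|]. *)
Lemma prob_perm_all_in s B : uniq s ->
  prob R (fun p : {perm X} => all (fun i => p i \in B) s) <= d B ^+ size s.
Proof.
elim: s => [_|i s IH /= /andP[is_ us]].
  rewrite expr0 -[leRHS](mean_cst (T := {perm X}) 1 card_perm_gt0).
  by apply: le_mean => p; rewrite lern1 leq_b1.
set Q := prob R _; pose P j := prob R (fun p : {perm X} => all (fun i => p i \in B) (j :: s)).
have PE j : j \notin s -> P j = Q.
  move=> js; rewrite /P /Q /prob -[RHS](mean_bij _ (mulgI (tperm i j))).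
  apply: eq_mean => p; congr (nat_of_bool _)%:R; rewrite /= permM tpermL; congr andb.
  apply: eq_in_all => k ks; rewrite permM tpermD //.
    by apply: contraNneq is_ => ->.
  by apply: contraNneq js => ->.
have sX : (size s < #|X|)%N.
  have uis : uniq (i :: s) by rewrite /= is_ us.
  by have /card_uniqP/= <- := uis; exact: max_card.
(* Summing over the possible further points: by symmetry they all have the probability [Q], and exactly [#|B| - size s] of them land in [B]. *)
have sum : (#|X|%:R - (size s)%:R) * Q = (#|B|%:R - (size s)%:R) *
    prob R (fun p : {perm X} => all (fun i => p i \in B) s).
  transitivity (\sum_(j | j \notin s) P j).
    rewrite (eq_bigr (fun=> Q)) => [|j]; last exact: PE.
    rewrite sumr_const -[in RHS]mulr_natl; congr (_ * _).
    by rewrite -natrB 1?ltnW // -(cardC [in s]) (card_uniqP us) addKn; congr _%:R; apply: eq_card => j; rewrite !inE.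
  rewrite /P /prob -mean_sum -meanZl; apply: eq_mean => p /=.
  case: (boolP (all _ s)) => [/allP sB|_]; last first.
    by rewrite mulr0 big1 // => j _; rewrite andbF.
  rewrite mulr1 -natr_sum; under eq_bigr do rewrite andbT.
  rewrite -big_mkcondr /= sum1_card -(card_preimset B (perm_inj (s := p))).
  rewrite -(cardID [in s] (p @^-1: B)).
  have -> : #|[predI p @^-1: B & [in s]]| = size s.
    rewrite -(card_uniqP us); apply: eq_card => j; rewrite !inE.
    by case: (boolP (j \in s)) => [/sB->|_]; rewrite ?andbF.
  rewrite natrD addrAC subrr add0r; congr _%:R; apply: eq_card => j.
  by rewrite !inE.
have xs : 0 < #|X|%:R - (size s)%:R :> R by rewrite subr_gt0 ltr_nat.
have x0 : 0 < #|X|%:R :> R by rewrite ltr0n (leq_ltn_trans _ sX).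
have IH' := IH us; set P' := prob R _ in sum IH'.
have P'0 : 0 <= P' by exact: prob_ge0.
have -> : Q = (#|B|%:R - (size s)%:R) * P' / (#|X|%:R - (size s)%:R).
  by rewrite -sum mulrC mulKf // gt_eqF.
rewrite exprS; apply: le_trans (ler_wpM2l _ IH'); last by rewrite divr_ge0.
rewrite mulrAC ler_wpM2r // ler_pdivrMr // mulrAC ler_pdivlMr //.
have BX : #|B|%:R <= #|X|%:R :> R by rewrite ler_nat max_card.
have s0 : 0 <= (size s)%:R :> R by rewrite ler0n.
nra.
Qed.

(** Induction on [r]: expanding the factor of its first point either drops this point or moves it to the list [s] of points forced into [B]. *)
Lemma perm_mgf_seq s r B (a : R) : 0 <= a -> uniq (s ++ r) ->
  mean (fun p : {perm X} => (all (fun i => p i \in B) s)%:R *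
     \prod_(i <- r) (1 + a * (p i \in B)%:R)) <=
  d B ^+ size s * (1 + a * d B) ^+ size r.
Proof.
move=> a0; elim: r s => [|i r IH] s us.
  rewrite mulr1; apply: le_trans (prob_perm_all_in _ _).
    by apply: le_mean => p; rewrite big_nil mulr1.
  by rewrite cats0 in us.
have us' : uniq (rcons s i ++ r) by rewrite cat_rcons.
have us2 : uniq (s ++ r).
  by move: us; rewrite -cat_rcons -cats1 -catA uniq_catCA /= => /andP[].
have d0 : 0 <= d B by rewrite divr_ge0.
apply: (@le_trans _ _ (d B ^+ size s * (1 + a * d B) ^+ size r +
   a * (d B ^+ (size s).+1 * (1 + a * d B) ^+ size r))); last first.
  by rewrite /= !exprS le_eqVlt; apply/orP; left; apply/eqP; ring.
apply: le_trans (lerD (IH _ us2) (ler_wpM2l a0 _)); last first.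
  by rewrite -(size_rcons s i); exact: (IH _ us').
rewrite -meanZl -meanD; apply: le_mean => p; rewrite big_cons all_rcons.
rewrite -mulnb natrM le_eqVlt; apply/orP; left; apply/eqP; ring.
Qed.

(** Negative correlation in generating function form: the right-hand side is that of a binomial law with the same mean. *)
Lemma perm_mgf A B (a : R) : 0 <= a ->
  mean (fun p : {perm X} => (1 + a) ^+ #|[set i in A | p i \in B]|) <=
  (1 + a * d B) ^+ #|A|.
Proof.
move=> a0; have := perm_mgf_seq (s := [::]) (r := enum A) B a0 (enum_uniq A).
rewrite expr0 mul1r -cardE; apply: le_trans; apply: le_mean => p.
rewrite mul1r big_enum /= le_eqVlt; apply/orP; left; apply/eqP.
rewrite (bigID (fun i => p i \in B)) /= [X in _ * X]big1 ?mulr1 => [|i]; last first.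
  by move=> /andP[_ /negPf->]; rewrite mulr0 addr0.
rewrite -prodr_const; apply: eq_big => [i|i]; first by rewrite inE.
by rewrite inE => /andP[_ ->]; rewrite mulr1.
Qed.

End RandomPerm.

(** * The upper tail *)

Section EdgesInside.
Variables (R : realType) (n l : nat).
Local Notation V := 'I_n.
Local Notation T := (V * 'I_l)%type.
Local Notation matchings := {ffun V * V -> {perm 'I_l}}.
Implicit Types (s : matchings) (S : {set T}).

Definition slice S (u : V) : {set 'I_l} := [set i | (u, i) \in S].

Definition edges_in s S : nat :=
  (\sum_(p : V * V | p.1 < p.2) #|[set i in slice S p.1 | s p i \in slice S p.2]|)%N.

Lemma sum_slice S : (\sum_u #|slice S u| = #|S|)%N.
Proof.
rewrite -sum1_card (eq_bigr (fun u => \sum_i ((u, i) \in S))%N) => [|u _].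
  by rewrite pair_big /= -big_mkcond; apply: eq_bigl => -[].
by rewrite -sum1_card big_mkcond; apply: eq_bigr => i _; rewrite inE; case: (_ \in S).
Qed.

(** The square of a sum is at least twice the sum of its products over unordered pairs of distinct terms. *)
Lemma sum_slice_pairs S :
  ((\sum_(p : V * V | p.1 < p.2) #|slice S p.1| * #|slice S p.2|) * 2 <= #|S| ^ 2)%N.
Proof.
pose f (p : V * V) := (#|slice S p.1| * #|slice S p.2|)%N.
rewrite -[#|S|]sum_slice expnS expn1 [leqRHS]big_distrl /=.
under [leqRHS]eq_bigr do rewrite big_distrr /=.
rewrite pair_big /= [leqRHS](bigID (fun p : V * V => (p.1 < p.2)%N)) /= muln2 -addnn leq_add2l.
rewrite [leqRHS](bigID (fun p : V * V => (p.2 < p.1)%N)) /=.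
apply: leq_trans (leq_addr _ _).
rewrite [leqLHS](reindex_inj (h := fun p : V * V => (p.2, p.1))) /=; last by move=> [? ?] [? ?] [-> ->].
rewrite [leqRHS](eq_bigl (fun p : V * V => (p.2 < p.1)%N)) => [|p]; last first.
  by case: (ltngtP p.1 p.2); rewrite ?andbT ?andbF.
by apply: eq_leq; apply: eq_bigr => p _; rewrite mulnC.
Qed.

(** The matchings between distinct pairs of fibers are independent, so the generating function factors; each factor is bounded by [perm_mgf] and then by an exponential. *)
Lemma edges_in_mgf S (a : R) : 0 <= a ->
  mean (fun s => (1 + a) ^+ edges_in s S) <=
  expR (a * #|S|%:R ^+ 2 / (2 * l%:R)).
Proof.
move=> a0; pose r := seq.filter (fun p : V * V => (p.1 < p.2)%N) (index_enum _).
have ->: mean (fun s => (1 + a) ^+ edges_in s S) =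
  mean (fun s => \prod_(p <- r)
     (1 + a) ^+ #|[set i in slice S p.1 | s p i \in slice S p.2]|).
  by apply: eq_mean => s; rewrite big_filter expr_sum.
rewrite (mean_prod (key := id) (fun p (q : {perm 'I_l}) =>
  (1 + a) ^+ #|[set i in slice S p.1 | q i \in slice S p.2]|)); last first.
- by move=> p q _ _.
- by rewrite filter_uniq // index_enum_uniq.
- exact: card_perm_gt0.
rewrite big_filter.
apply: (@le_trans _ _ (\prod_(p : V * V | (p.1 < p.2)%N)
   expR (a / l%:R * (#|slice S p.1| * #|slice S p.2|)%:R))).
  apply: ler_prod => p _; apply/andP; split.
    by apply: mean_ge0 => q; rewrite exprn_ge0 // addr_ge0.
  apply: le_trans (perm_mgf _ _ a0) _; rewrite card_ord.
  have -> : a / l%:R * (#|slice S p.1| * #|slice S p.2|)%:R =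
     (a * (#|slice S p.2|%:R / l%:R)) * #|slice S p.1|%:R by rewrite natrM; ring.
  rewrite expRM_natr lerXn2r ?nnegrE ?expR_ge0 //; last exact: expR_ge1Dx.
  by rewrite addr_ge0 // mulr_ge0 // divr_ge0.
rewrite -expR_sum ler_expR -mulr_sumr -natr_sum.
have := sum_slice_pairs S; rewrite -(ler_nat R) natrM natrX => le2.
have -> : a * #|S|%:R ^+ 2 / (2 * l%:R) = a / l%:R * (#|S|%:R ^+ 2 / 2).
  by rewrite invfM; ring.
by rewrite ler_wpM2l ?divr_ge0 // ler_pdivlMr.
Qed.

Lemma card_ltn_pairs m : (#|[set p : 'I_m * 'I_m | p.1 < p.2]| * 2 = m * m.-1)%N.
Proof.
have -> : #|[set p : 'I_m * 'I_m | (p.1 < p.2)%N]| = 'C(m, 2); last first.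
  by rewrite mulnC -mul_bin_diag bin1.
rewrite -[LHS]sum1_card (eq_bigl (fun p : 'I_m * 'I_m => (p.1 < p.2)%N)); last first.
  by move=> p; rewrite inE.
rewrite big_mkcond -(pair_big xpredT xpredT (fun i j : 'I_m => if (i < j)%N then 1%N else 0%N)) /=.
rewrite exchange_big /= -bin2_sum big_mkord; apply: eq_bigr => j _.
rewrite -big_mkcond /= sum1_card.
have -> : #|[pred i : 'I_m | (i < j)%N]| = #|[set: 'I_j]|; last by rewrite cardsT card_ord.
rewrite -(card_imset _ (f := widen_ord (ltnW (ltn_ord j)))); last first.
  by move=> a b /(congr1 val) /= /val_inj.
apply: eq_card => i; rewrite !inE; apply/idP/imsetP => [ij|[k _ ->]]; last by rewrite /=.
by exists (Ordinal ij); rewrite ?inE //; apply: val_inj.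
Qed.

(** A lift edge between two fibers is counted once, from its end in the smaller fiber. *)
Lemma edges_inE s S : edges_in s S = #|[set r : (V * V) * 'I_l |
  (r.1.1 < r.1.2)%N && (((r.1.1, r.2) \in S) && ((r.1.2, s r.1 r.2) \in S))]|.
Proof.
rewrite -[RHS]sum1_card big_mkcond /=.
rewrite (eq_bigr (fun r : (V * V) * 'I_l => nat_of_bool ((r.1.1 < r.1.2)%N &&
  (((r.1.1, r.2) \in S) && ((r.1.2, s r.1 r.2) \in S))))); last first.
  by move=> r _; rewrite inE; case: (_ && _).
rewrite -(pair_big xpredT xpredT (fun (p : V * V) i => nat_of_bool ((p.1 < p.2)%N &&
  (((p.1, i) \in S) && ((p.2, s p i) \in S))))) /= /edges_in big_mkcond /=.
apply: eq_bigr => p _; case: ifP => _; last by rewrite big1.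
rewrite -sum1_card big_mkcond /=; apply: eq_bigr => i _.
by rewrite !inE; case: (_ && _).
Qed.

(** The counting constraint.  A pair of branch vertices is either adjacent, and then an edge inside [S], or owns the first internal vertex of its path, which belongs to no other pair. *)
Lemma clique_edges s m : has_topological_clique (lift_of s) m ->
  exists2 S : {set T}, #|S| = m &
    (m * m.-1 <= (edges_in s S + n * l) * 2)%N.
Proof.
move=> [b [p [bI pth _ _ pdisj]]]; exists [set b i | i in 'I_m].
  by rewrite card_imset // card_ord.
set S := [set b i | i in 'I_m].
rewrite -card_ltn_pairs leq_mul2r /=.
set D := [set _ | _]; pose E := [set q : 'I_m * 'I_m | lift_adj s (b q.1) (b q.2)].
rewrite -(cardsID E D) leq_add //.
  pose g (q : 'I_m * 'I_m) : T * T :=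
    if ((b q.1).1 < (b q.2).1)%N then (b q.1, b q.2) else (b q.2, b q.1).
  pose h (q : T * T) : (V * V) * 'I_l := ((q.1.1, q.2.1), q.1.2).
  have gP q : q \in D :&: E -> [/\ ((g q).1 \in S) && ((g q).2 \in S), ((g q).1.1 < (g q).2.1)%N &
     lift_adj s (g q).1 (g q).2].
    rewrite !inE /g => /andP[_ qE]; have nq : (b q.1).1 != (b q.2).1 by case/andP: qE.
    case: ifP => lt /=; rewrite !imset_f //; split => //; last by rewrite lift_adj_sym.
    by rewrite ltn_neqAle eq_sym nq leqNgt lt.
  have hI q q' : q \in D :&: E -> q' \in D :&: E -> h (g q) = h (g q') -> g q = g q'.
    move=> /gP[_ lt /andP[_ /eqP]] + /gP[_ lt' /andP[_ /eqP]].
    move: (g q) (g q') lt lt' => [[u i] [v j]] [[u' i'] [v' j']] /=.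
    by rewrite /partner => lt lt'; rewrite lt lt' => <- <- [-> -> ->].
  have gI : {in D :&: E &, injective (h \o g)}.
    move=> [i j] [i' j'] /= d d' /(hI _ _ d d').
    move: d d'; rewrite !inE /= /g /= => /andP[ij _] /andP[ij' _].
    case: ifP; case: ifP => _ _ [/bI e1 /bI e2]; rewrite -?e1 -?e2 //;
      move: ij ij'; rewrite e1 e2 => a c; by have := ltn_trans a c; rewrite ltnn.
  rewrite -(card_in_imset gI) edges_inE; apply: subset_leq_card.
  apply/subsetP => _ /imsetP[q qDE ->]; have [+ lt /andP[_ /eqP]] := gP q qDE.
  rewrite !inE /=; case: (g q) lt => [[u i] [v j]] /= lt.
  by rewrite /partner lt => + -> => ->.
have -> : (n * l = #|{: T}|)%N by rewrite card_prod !card_ord.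
pose f (q : 'I_m * 'I_m) := head (b q.1) (p q.1 q.2).
have fp q : q \in D :\: E -> f q \in p q.1 q.2.
  rewrite !inE /f => /andP[qE qD]; have := pth _ _ qD.
  case: (p q.1 q.2) => [|x r] /=; last by rewrite mem_head.
  by rewrite andbT adj_lift_of (negPf qE).
have fI : {in D :\: E &, injective f}.
  move=> q q' qd qd' e; apply/eqP; apply: contraT => ne; have := fp q qd.
  move: (qd) (qd'); rewrite !inE => /andP[_ qD] /andP[_ qD'].
  move=> /(pdisj _ _ q'.1 q'.2 qD qD'); rewrite -!surjective_pairing e => /(_ ne).
  by rewrite fp.
by rewrite -(card_in_imset fI) max_card.
Qed.

Lemma clique_le m m' s : (m' <= m)%N ->
  has_topological_clique (lift_of s) m -> has_topological_clique (lift_of s) m'.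
Proof.
move=> mm [b [p [bI H1 H2 H3 H4]]]; pose w := widen_ord mm.
have wI : injective w by move=> i j /(congr1 val) /= /val_inj.
exists (b \o w), (fun i j => p (w i) (w j)); split.
- exact: inj_comp.
- by move=> i j ij; apply: (H1 (w i) (w j)).
- by move=> i j ij; apply: (H2 (w i) (w j)).
- by move=> i j k ij; apply: (H3 (w i) (w j)).
- move=> i j i' j' ij ij' ne; apply: (H4 (w i) (w j) (w i') (w j')) => //.
Qed.

(** Markov's inequality for [(1 + a) ^ edges_in s S], followed by a union bound over [S], enumerated as the image of a function on ['I_m].  The form of the denominator comes from [expR (a - a ^ 2) <= 1 + a]. *)
Lemma prob_hajos_ge m (a : R) : 0 <= a <= 1 ->
  prob R (fun s => (m <= hajos (lift_of s))%N) <=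
  (n * l)%:R ^+ m * (expR (a * m%:R ^+ 2 / (2 * l%:R)) /
    expR ((a - a ^+ 2) * ((m * m.-1)%:R / 2 - (n * l)%:R))).
Proof.
move=> /andP[a0 a1]; set c := expR _ / _.
pose K : R := (m * m.-1)%:R / 2 - (n * l)%:R.
have step S : #|S| = m ->
    prob R (fun s => (m * m.-1 <= (edges_in s S + n * l) * 2)%N) <= c.
  move=> Sm; apply: le_trans (mean_markov (h := fun s => (1 + a) ^+ edges_in s S)
     (c := expR ((a - a ^+ 2) * K)) _ _ _) _.
  - exact: expR_gt0.
  - by move=> s; rewrite exprn_ge0 // addr_ge0.
  - move=> s le; apply: (@le_trans _ _ (expR ((a - a ^+ 2) * (edges_in s S)%:R))).
      rewrite ler_expR ler_wpM2l //; first by nra.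
      rewrite /K lerBlDr ler_pdivrMr // -natrD -[2]/(2%:R) -natrM ler_nat //.
    rewrite expRM_natr lerXn2r ?nnegrE ?expR_ge0 ?addr_ge0 //.
    have := expR_ge1Dx (- (a - a ^+ 2)); rewrite expRN.
    set E := expR _ => le1; have E0 : 0 < E by exact: expR_gt0.
    have le2 : (1 + - (a - a ^+ 2)) * E <= 1 by rewrite -ler_pdivlMr // div1r.
    have w0 : 0 < 1 + - (a - a ^+ 2) by nra.
    rewrite -(ler_pM2l w0); apply: le_trans le2 _.
    have -> : (1 + - (a - a ^+ 2)) * (1 + a) = 1 + a ^+ 3 by ring.
    by rewrite lerDl exprn_ge0.
  - rewrite /c ler_wpM2r ?invr_ge0 ?expR_ge0 //.
    by have := edges_in_mgf S a0; rewrite Sm.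
apply: (@le_trans _ _ (prob R (fun s => [exists b : {ffun 'I_m -> T},
   (#|[set b i | i : 'I_m]| == m) &&
   (m * m.-1 <= (edges_in s [set b i | i : 'I_m] + n * l) * 2)%N]))).
  apply: le_prob => s /clique_le/(_ (hajosP _))/clique_edges[S Sm le].
  apply/existsP; subst m; exists [ffun i => enum_val i].
  suff -> : [set [ffun i => enum_val i] i | i : 'I_#|S|] = S by rewrite eqxx.
  apply/setP => x; apply/imsetP/idP => [[i _ ->]|xS]; rewrite ?ffunE ?enum_valP //.
  by exists (enum_rank_in xS x); rewrite ?ffunE ?enum_rankK_in.
apply: (@le_trans _ _ (prob R (fun s =>
  [exists b in [pred b : {ffun 'I_m -> T} | #|[set b i | i : 'I_m]| == m],
   (m * m.-1 <= (edges_in s [set b i | i : 'I_m] + n * l) * 2)%N]))).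
  by apply: le_prob => s /existsP[b /andP[bm be]]; apply/existsP; exists b; rewrite inE bm.
apply: le_trans (prob_exists _ _ _) _.
apply: (@le_trans _ _ (\sum_(b : {ffun 'I_m -> T} | #|[set b i | i : 'I_m]| == m) c)).
  by apply: ler_sum => b /eqP bm; apply: step.
have c0 : 0 <= c by rewrite divr_ge0 ?expR_ge0.
apply: (@le_trans _ _ (\sum_(b : {ffun 'I_m -> T}) c)).
  by rewrite [leRHS](bigID (fun b : {ffun 'I_m -> T} => #|[set b i | i : 'I_m]| == m)) /= lerDl sumr_ge0.
by rewrite sumr_const card_ffun card_prod !card_ord -[_ *+ _]mulr_natl natrX.
Qed.

End EdgesInside.

(** * Greedy linking *)

Section Link.
Local Open Scope nat_scope.
Variables (B : eqType) (s : nat) (ok : B -> B -> rel 'I_s).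

(** [ok x y i j] says that the [i]-th reserved neighbour of [x] is adjacent to the [j]-th reserved neighbour of [y]. *)
Definition well_linked := forall x y (V V' : {set 'I_s}),
  s <= #|V| * 2 -> s <= #|V'| * 2 -> exists v v', [/\ v \in V, v' \in V' & ok x y v v'].

(** Greedy choice: when a pair [(x, y)] is treated, fewer than half of the reserved neighbours of [x], and of [y], are in use, because only pairs containing [x] in the same position use them. *)
Lemma disjoint_links (z : 'I_s) (L : seq (B * B)) : well_linked -> uniq L ->
  (forall x, count (fun e => e.1 == x) L * 2 <= s) ->
  (forall y, count (fun e => e.2 == y) L * 2 <= s) ->
  exists f : B * B -> 'I_s * 'I_s, forall e, e \in L ->
    ok e.1 e.2 (f e).1 (f e).2 /\
    forall e', e' \in L -> e != e' ->
      (e.1 = e'.1 -> (f e).1 <> (f e').1) /\ (e.2 = e'.2 -> (f e).2 <> (f e').2).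
Proof.
move=> WL; elim: L => /= [_ _ _|e L IH /andP[eL uL] d1 d2].
  by exists (fun=> (z, z)).
have [||f fP] := IH uL.
- by move=> x; apply: leq_trans (d1 x); rewrite leq_mul2r leq_addl orbT.
- by move=> y; apply: leq_trans (d2 y); rewrite leq_mul2r leq_addl orbT.
pose used (T : eqType) (p : B * B -> T) (q : 'I_s * 'I_s -> 'I_s) :=
  [set z in [seq q (f e') | e' <- L & p e' == p e]].
have usedP (T : eqType) (p : B * B -> T) q e' :
    e' \in L -> p e = p e' -> q (f e') \in used T p q.
  move=> e'L pe; rewrite inE; apply/mapP; exists e' => //.
  by rewrite mem_filter pe eqxx.
have free (T : eqType) (p : B * B -> T) q :
    (p e == p e) + count (fun e' => p e' == p e) L <= s./2 -> s <= #|~: used T p q| * 2.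
  rewrite eqxx => c; rewrite cardsCs setCK card_ord.
  have : #|used T p q| <= count (fun e' => p e' == p e) L.
    by rewrite cardsE -size_filter -(size_map (fun e' => q (f e'))) card_size.
  move: c; have := odd_double_half s; lia.
have half c : c * 2 <= s -> c <= s./2 by move: (odd_double_half s); lia.
have [v [v' [vV v'V okvv]]] := WL e.1 e.2 _ _
  (free _ fst fst (half _ (d1 e.1))) (free _ snd snd (half _ (d2 e.2))).
exists (fun e' => if e' == e then (v, v') else f e').
have new e' : e' \in L -> (e.1 = e'.1 -> v <> (f e').1) /\ (e.2 = e'.2 -> v' <> (f e').2).
  move=> e'L; split=> E1 E2.
    by move: vV; rewrite E2 inE (usedP _ fst fst e').
  by move: v'V; rewrite E2 inE (usedP _ snd snd e').
move=> e1; rewrite inE => /predU1P[->|e1L].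
  rewrite eqxx; split => // e'; rewrite inE eq_sym => /predU1P[->|e'L]; first by rewrite eqxx.
  by move=> /negPf->; apply: new.
have e1e : (e1 == e) = false by apply: contraNF eL => /eqP <-.
rewrite e1e; have [ok1 dis1] := fP _ e1L; split => // e'; rewrite inE => /predU1P[-> _|e'L].
  by rewrite eqxx; have [N1 N2] := new _ e1L; split => /esym E1 /esym; [apply: N1 | apply: N2].
have -> : (e' == e) = false by apply: contraNF eL => /eqP <-.
exact: dis1.
Qed.
End Link.

Section Greedy.
Local Open Scope nat_scope.
Variables (B : finType) (l : nat).
Implicit Types (F : {set B * B}) (C : 'I_l -> {set B}).

(** [C j] stands for the set of branch vertices seen by the [j]-th vertex of a connector fiber, which serves one of the pairs that it sees, if any. *)
Definition picked F C (j : 'I_l) : option (B * B) :=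
  [pick e in F | (e.1 \in C j) && (e.2 \in C j)].

Definition serve F C : {set B * B} :=
  F :\: [set e | [exists j, picked F C j == Some e]].

Definition idle F C : nat := #|[set j | picked F C j == None]|.

Lemma picked_in F C j e : picked F C j = Some e ->
  [/\ e \in F, e.1 \in C j & e.2 \in C j].
Proof. by rewrite /picked; case: pickP => // e' /and3P[? ? ?] [<-]. Qed.

(** The sets [C j] are disjoint, so two vertices of the fiber never serve the same pair and the number of pairs served is at least [l - idle F C]. *)
Lemma card_serve F C : (forall j j' x, x \in C j -> x \in C j' -> j = j') ->
  #|serve F C| + l <= #|F| + idle F C.
Proof.
move=> Cdisj; rewrite -(cardsID [set e | [exists j, picked F C j == Some e]] F).
rewrite addnC [X in _ <= X]addnAC leq_add2r.
rewrite -[X in X <= _](card_ord l) -(cardsC [set j | picked F C j == None]) addnC leq_add2r.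
have [->|/set0Pn[j0]] := eqVneq (~: [set j | picked F C j == None]) set0.
  by rewrite cards0.
rewrite !inE; case e0: (picked F C j0) => [e|//] _.
pose g j := odflt e (picked F C j).
rewrite -(card_in_imset (f := g)) => [|j j']; last first.
  rewrite !inE /g; case E: (picked F C j) => [f|//] _; case E': (picked F C j') => [f'|//] _ /= ff.
  have [_ ? _] := picked_in E; have [_ ? _] := picked_in E'.
  by subst f'; apply: Cdisj; eauto.
apply: subset_leq_card; apply/subsetP => _ /imsetP[j + ->].
rewrite !inE /g; case E: (picked F C j) => [f|//] _ /=.
by case: (picked_in E) => -> _ _; apply/existsP; exists j; rewrite E.
Qed.

End Greedy.

Section GreedyRun.
Local Open Scope nat_scope.
Variables (B : finType) (l : nat) (V : eqType) (cls : V -> 'I_l -> {set B}).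
Hypothesis cls_disjoint : forall v j j' x, x \in cls v j -> x \in cls v j' -> j = j'.
Implicit Types (F : {set B * B}) (vs : seq V).

Definition run F vs := foldl (fun F v => serve F (cls v)) F vs.

(** Idle vertices are counted only while at least [M] pairs are waiting: idleness is improbable only then, and only then does [card_run] need the count. *)
Fixpoint idle_total M F vs : nat :=
  if vs is v :: vs' then
    (if M <= #|F| then idle F (cls v) else 0) + idle_total M (serve F (cls v)) vs'
  else 0.

Lemma run_subset F vs : run F vs \subset F.
Proof.
elim: vs F => //= v vs IH F; apply: subset_trans (IH _) _; exact: subsetDl.
Qed.

Lemma card_run M F vs : M <= #|run F vs| ->
  #|run F vs| + size vs * l <= #|F| + idle_total M F vs.
Proof.
elim: vs F => [|v vs IH] F /= MF; first by rewrite mul0n.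
have MF0 : M <= #|F|.
  apply: leq_trans MF _; apply: leq_trans (subset_leq_card (run_subset _ _)) _.
  by apply: subset_leq_card; apply: subsetDl.
rewrite MF0; have := IH _ MF; have := card_serve F (cls_disjoint (v := v)).
rewrite mulSn; move: (size vs * l) (idle_total _ _ _) (idle _ _) #|serve _ _| #|run _ vs| #|F|.
by move=> a b c d e f; lia.
Qed.

(** Recording for each connector vertex the pair that it serves makes the disjointness of the resulting paths automatic. *)
Lemma run_assignment F vs : uniq vs -> exists asg : V -> 'I_l -> option (B * B),
  {in F :\: run F vs, forall e, exists v j, [/\ v \in vs, asg v j = Some e,
     e.1 \in cls v j & e.2 \in cls v j]}.
Proof.
elim: vs F => [|v vs IH] F /=.
  by move=> _; exists (fun _ _ => None) => e; rewrite inE => /andP[/negPf->].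
move=> /andP[vvs /(IH (serve F (cls v)))[asg asgP]].
exists (fun u j => if u == v then picked F (cls v) j else asg u j) => e.
rewrite inE => /andP[eR eF]; case: (boolP (e \in serve F (cls v))) => eS.
  have [|u [j [uvs ue e1 e2]]] := asgP e; first by rewrite inE eR.
  exists u, j; rewrite inE uvs orbT; case: eqVneq => [uv|_] //.
  by rewrite -uv uvs in vvs.
have /existsP[j /eqP Ej] : [exists j, picked F (cls v) j == Some e].
  by move: eS; rewrite !inE eF andbT negbK.
have [_ e1 e2] := picked_in Ej.
by exists v, j; rewrite eqxx mem_head.
Qed.

End GreedyRun.

(** * Random transversals *)

(** Chebyshev's inequality for the number of events [Y p] that occur; only the dependent pairs contribute to its variance, each by at most [1]. *)
Lemma second_moment (R : realFieldType) (T P : finType) (U : {set P})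
    (Y : P -> pred T) (dep : rel P) : (0 < #|T|)%N ->
  (forall p q, p \in U -> q \in U -> ~~ dep p q ->
     prob R (fun t => Y p t && Y q t) = prob R (Y p) * prob R (Y q)) ->
  prob R (fun t => [forall p in U, ~~ Y p t]) * (\sum_(p in U) prob R (Y p)) ^+ 2 <=
  #|[set pq : P * P | dep pq.1 pq.2]|%:R.
Proof.
move=> T0 indep; set mu := \sum_(p in U) _.
pose Z t : R := \sum_(p in U) (Y p t)%:R.
apply: (@le_trans _ _ (mean (fun t => (Z t - mu) ^+ 2))).
  rewrite -meanZr; apply: le_mean => t.
  case: (boolP [forall p in U, _]) => [/forall_inP noY|_]; last by rewrite mul0r sqr_ge0.
  rewrite /Z big1 => [|p /noY/negPf->//]; by rewrite mul1r sub0r sqrrN.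
have -> : mean (fun t => (Z t - mu) ^+ 2) = mean (fun t => Z t ^+ 2) - mu ^+ 2.
  have -> : mean (fun t => (Z t - mu) ^+ 2) =
      mean (fun t => (Z t ^+ 2 + (- 2 * mu) * Z t) + mu ^+ 2).
    by apply: eq_mean => t; ring.
  rewrite !meanD meanZl mean_cst // {2}/Z mean_sum -/mu; ring.
have -> : mean (fun t => Z t ^+ 2) =
    \sum_(p in U) \sum_(q in U) prob R (fun t => Y p t && Y q t).
  rewrite (eq_mean (g := fun t => \sum_(p in U) \sum_(q in U) (Y p t && Y q t)%:R)).
    by rewrite mean_sum; apply: eq_bigr => p _; rewrite mean_sum.
  move=> t; rewrite expr2 {1}/Z mulr_suml; apply: eq_bigr => p _.
  by rewrite mulr_sumr; apply: eq_bigr => q _; rewrite -natrM mulnb.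
have -> : mu ^+ 2 = \sum_(p in U) \sum_(q in U) prob R (Y p) * prob R (Y q).
  by rewrite expr2 {1}/mu mulr_suml; apply: eq_bigr => p _; rewrite mulr_sumr.
rewrite -sumrB; apply: (@le_trans _ _ (\sum_p \sum_q (dep p q)%:R)); last first.
  rewrite pair_big /= -natr_sum ler_nat -sum1_card [leqRHS]big_mkcond /=.
  by apply: leq_sum => -[p q] _; rewrite inE; case: (dep _ _).
rewrite [leLHS]big_mkcond; apply: ler_sum => p _; case: ifP => [pU|_]; last by rewrite sumr_ge0.
rewrite -sumrB [leLHS]big_mkcond; apply: ler_sum => q _; case: ifP => // qU.
case: (boolP (dep p q)) => [_|pq]; last by rewrite indep // subrr.
rewrite lerBlDr; apply: (@le_trans _ _ 1); last by rewrite lerDl mulr_ge0 // prob_ge0.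
rewrite -[leRHS](mean_cst 1 T0); apply: le_mean => t; by rewrite lern1 leq_b1.
Qed.

Section RandomPartners.
Variables (R : realFieldType) (n l : nat).
Local Notation V := 'I_n.
Local Notation T := (V * 'I_l)%type.
Local Notation matchings := {ffun V * V -> {perm 'I_l}}.
Implicit Types (s t : matchings).

Definition pair_coord (u v : V) : V * V := if (u < v)%N then (u, v) else (v, u).

Lemma pair_coord_inj v : injective (pair_coord v).
Proof.
move=> u u'; rewrite /pair_coord; case: ifP => h; case: ifP => h' [] //.
  by move=> -> ->.
by move=> <- ->.
Qed.

Lemma partner_depends u v i : depends_on [set pair_coord u v] (fun s => partner s u v i).
Proof.
move=> s t st; rewrite /partner; have := st (pair_coord u v) (set11 _).
by rewrite /pair_coord; case: ifP => _ ->.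
Qed.

Definition oriented u v (q : {perm 'I_l}) : {perm 'I_l} :=
  if (u < v)%N then q else (q^-1)%g.

Lemma partnerE s u v : partner s u v = oriented u v (s (pair_coord u v)).
Proof. by rewrite /partner /oriented /pair_coord; case: ifP. Qed.

Lemma prob_oriented u v i j :
  prob R (fun q : {perm 'I_l} => oriented u v q i == j) = l%:R^-1.
Proof.
rewrite -[in RHS](card_ord l) /oriented; case: (u < v)%N; first exact: prob_perm_coord.
rewrite -(prob_perm_coord R j i); apply: eq_prob => q.
by rewrite (can2_eq (permKV _) (permK _)) eq_sym.
Qed.

Lemma card_matchings_gt0 : (0 < #|{: matchings}|)%N.
Proof. exact/card_Omega_gt0/card_perm_gt0. Qed.

Lemma prob_partner u v i j : prob R (fun s => partner s u v i == j) = l%:R^-1.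
Proof.
rewrite -(prob_oriented u v i j) /prob.
rewrite -(mean_coord (pair_coord u v) (fun q => (oriented u v q i == j)%:R)) ?card_perm_gt0 //.
by apply: eq_mean => s; rewrite partnerE.
Qed.

Section Transversal.
Variables (k : nat) (br : 'I_k -> V) (v : V) (j : 'I_l).
Hypothesis br_inj : injective br.
Local Notation B := ('I_k * 'I_l)%type.
Implicit Types (F : {set B * B}) (p : 'I_k * 'I_k).

(** The vertex in position [j] of the fiber [v] sees one vertex in each branch fiber. *)
Definition seen s u : B := (u, partner s v (br u) j).

Definition seen_pair F p s := (seen s p.1, seen s p.2) \in F.

Lemma seen_pair_depends F p :
  depends_on [set pair_coord v (br p.1); pair_coord v (br p.2)] (seen_pair F p).
Proof.
move=> s t st; rewrite /seen_pair /seen; congr (((_, _), (_, _)) \in F).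
  by apply: partner_depends => c /set1P->; apply: st; rewrite set21.
by apply: partner_depends => c /set1P->; apply: st; rewrite set22.
Qed.

(** The vertices seen in two different branch fibers are independent and uniform. *)
Lemma prob_seen_pair F p : p.1 != p.2 ->
  prob R (seen_pair F p) =
  #|[set e in F | (e.1.1 == p.1) && (e.2.1 == p.2)]|%:R / l%:R ^+ 2.
Proof.
move=> pp; set FF := [set e in F | _].
have -> : prob R (seen_pair F p) = \sum_(e in FF)
    prob R (fun s => (partner s v (br p.1) j == e.1.2) && (partner s v (br p.2) j == e.2.2)).
  rewrite /prob -mean_sum; apply: eq_mean => s; rewrite -natr_sum; congr _%:R.
  rewrite /seen_pair; case: (boolP (_ \in F)) => sF.
    rewrite (bigD1 (seen s p.1, seen s p.2)) /=; last by rewrite !inE sF /= !eqxx.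
    rewrite !eqxx big1 // => -[[u a] [u' a']] /=; rewrite !inE /=.
    move=> /andP[/and3P[_ /eqP-> /eqP->]] ne; apply/eqP; rewrite eqb0.
    by apply: contra ne => /andP[/eqP <- /eqP <-].
  rewrite big1 // => -[[u a] [u' a']]; rewrite !inE /= => /and3P[eF /eqP uE /eqP u'E].
  apply/eqP; rewrite eqb0; apply: contra sF => /andP[/eqP aE /eqP a'E].
  by rewrite /seen aE a'E -uE -u'E.
rewrite (eq_bigr (fun=> l%:R ^- 2)) => [|e _]; first by rewrite sumr_const mulr_natl.
rewrite -(exprVn l%:R) expr2 -{1}(prob_partner v (br p.1) j e.1.2) -(prob_partner v (br p.2) j e.2.2).
rewrite -(mean_indep (J := [set pair_coord v (br p.1)])).
- by apply: eq_mean => s; rewrite -natrM mulnb.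
- by move=> s t /partner_depends->.
- move=> s t st; congr (nat_of_bool (_ == _))%:R; apply: partner_depends => c /set1P->.
  apply: st; rewrite !inE; apply: contra pp => /eqP /pair_coord_inj /br_inj ->; exact: eqxx.
Qed.

(** Two events [seen_pair F p] and [seen_pair F q] are independent unless the pairs of fibers [p] and [q] meet, which happens for at most [4 * k ^ 3] couples [(p, q)]. *)
Lemma prob_no_seen_pair F : 
  prob R (fun s => [forall p in [set p | p.1 != p.2], ~~ seen_pair F p s]) *
    (#|[set e in F | e.1.1 != e.2.1]|%:R / l%:R ^+ 2) ^+ 2 <= (4 * k ^ 3)%:R.
Proof.
pose dep (p q : 'I_k * 'I_k) :=
  [|| p.1 == q.1, p.1 == q.2, p.2 == q.1 | p.2 == q.2].
have sumE : \sum_(p in [set p : 'I_k * 'I_k | p.1 != p.2]) prob R (seen_pair F p) =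
    #|[set e in F | e.1.1 != e.2.1]|%:R / l%:R ^+ 2.
  rewrite (eq_bigr (fun p : 'I_k * 'I_k =>
    #|[set e in F | (e.1.1 == p.1) && (e.2.1 == p.2)]|%:R / l%:R ^+ 2)) => [|p]; last first.
    by rewrite inE; exact: prob_seen_pair.
  rewrite -mulr_suml -natr_sum; congr (_%:R / _).
  rewrite -[RHS]sum1_card (partition_big (fun e : B * B => (e.1.1, e.2.1))
    (fun p => p \in [set p | p.1 != p.2])) /=; last by move=> e; rewrite !inE => /andP[].
  apply: eq_bigr => -[u u']; rewrite inE /= => uu'.
  rewrite -sum1_card; apply: eq_bigl => e; rewrite !inE -andbA; congr andb.
  by rewrite xpair_eqE; case: eqP => [->|] //=; case: eqP => [->|] //=; rewrite ?uu' ?andbF.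
rewrite -sumE; apply: le_trans (second_moment (dep := dep) card_matchings_gt0 _) _.
  move=> p q; rewrite !inE => pp qq.
  rewrite !negb_or => /and4P[n11 n12 n21 n22].
  rewrite -(mean_indep (J := [set pair_coord v (br p.1); pair_coord v (br p.2)])).
  - by apply: eq_mean => s; rewrite -natrM mulnb.
  - by move=> s t /seen_pair_depends->.
  - move=> s t st; congr (nat_of_bool _)%:R; apply: seen_pair_depends => c.
    move=> /set2P[] ->; apply: st; rewrite !inE;
    by apply/norP; split; rewrite (inj_eq (@pair_coord_inj v)) (inj_eq br_inj) eq_sym.
rewrite ler_nat.
have inj3 (f : ('I_k * 'I_k) * ('I_k * 'I_k) -> 'I_k * 'I_k * 'I_k) (A : {set _}) :
    {in A &, injective f} -> (#|A| <= k ^ 3)%N.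
  move=> fI; rewrite -(card_in_imset fI); apply: leq_trans (max_card _) _.
  by rewrite !card_prod !card_ord !expnS expn0 muln1 mulnA.
pose A1 := [set r : ('I_k * 'I_k) * ('I_k * 'I_k) | r.1.1 == r.2.1].
pose A2 := [set r : ('I_k * 'I_k) * ('I_k * 'I_k) | r.1.1 == r.2.2].
pose A3 := [set r : ('I_k * 'I_k) * ('I_k * 'I_k) | r.1.2 == r.2.1].
pose A4 := [set r : ('I_k * 'I_k) * ('I_k * 'I_k) | r.1.2 == r.2.2].
have leU (X Y : {set ('I_k * 'I_k) * ('I_k * 'I_k)}) a b :
    (#|X| <= a -> #|Y| <= b -> #|X :|: Y| <= a + b)%N.
  by move=> Xa Yb; apply: leq_trans (leq_card_setU X Y).1 (leq_add Xa Yb).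
have -> : [set r | dep r.1 r.2] = A1 :|: (A2 :|: (A3 :|: A4)).
  by apply/setP => r; rewrite !inE.
(* In each case the equality between two entries leaves three free ones. *)
rewrite !mulSn mul0n addn0; apply: (leU); last apply: (leU); last apply: (leU).
- apply: (inj3 (fun r => (r.1.1, r.1.2, r.2.2))) => -[[a b] [c d]] [[a' b'] [c' d']].
  by rewrite !inE /= => /eqP-> /eqP-> [-> -> ->].
- apply: (inj3 (fun r => (r.1.1, r.1.2, r.2.1))) => -[[a b] [c d]] [[a' b'] [c' d']].
  by rewrite !inE /= => /eqP-> /eqP-> [-> -> ->].
- apply: (inj3 (fun r => (r.1.1, r.1.2, r.2.2))) => -[[a b] [c d]] [[a' b'] [c' d']].
  by rewrite !inE /= => /eqP-> /eqP-> [-> -> ->].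
- apply: (inj3 (fun r => (r.1.1, r.1.2, r.2.1))) => -[[a b] [c d]] [[a' b'] [c' d']].
  by rewrite !inE /= => /eqP-> /eqP-> [-> -> ->].
Qed.

End Transversal.

End RandomPartners.

(** * Serving the pairs of branch vertices *)

Section BranchFibers.
Variables (R : realFieldType) (n l k : nat).
Local Notation V := 'I_n.
Local Notation T := (V * 'I_l)%type.
Local Notation B := ('I_k * 'I_l)%type.
Local Notation matchings := {ffun V * V -> {perm 'I_l}}.
Variable br : 'I_k -> V.
Hypothesis br_inj : injective br.
Implicit Types (s t : matchings) (v : V) (F : {set B * B}) (vs : seq V).

Definition branch (x : B) : T := (br x.1, x.2).

Lemma branch_inj : injective branch.
Proof. by move=> [u a] [u' a'] [/br_inj -> ->]. Qed.

Definition neighbours s v (j : 'I_l) : {set B} := [set x | lift_adj s (branch x) (v, j)].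

(** Each unordered pair is listed once, in the order of [enum_rank]. *)
Definition unlinked s : {set B * B} :=
  [set e | (enum_rank e.1 < enum_rank e.2)%N && ~~ lift_adj s (branch e.1) (branch e.2)].

Lemma neighbours_disjoint s v j j' x :
  x \in neighbours s v j -> x \in neighbours s v j' -> j = j'.
Proof. by rewrite !inE /lift_adj /= => /andP[_ /eqP<-] /andP[_ /eqP<-]. Qed.

(** A branch vertex has exactly [l - 1] non-neighbours other than itself in each branch fiber, its own one included. *)
Lemma card_unlinked s : (#|unlinked s| * 2 <= k * l * (k * l.-1))%N.
Proof.
pose A (x : B) := [set y : B | (x != y) && ~~ lift_adj s (branch x) (branch y)].
have cA x : #|A x| = (k * l.-1)%N.
  pose a u := if u == x.1 then x.2 else partner s (br x.1) (br u) x.2.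
  have -> : A x = [set y | y.2 != a y.1].
    apply/setP => -[u i]; rewrite !inE /lift_adj /branch /a /= (inj_eq br_inj).
    rewrite -pair_eqE /= /pair_eq /= [u == _]eq_sym.
    by case: eqVneq => [->|_] /=; rewrite ?andbT ?andTb eq_sym ?eqxx.
  rewrite -sum1_card (eq_bigl (fun y : B => true && (y.2 != a y.1))); last first.
    by move=> y; rewrite inE.
  rewrite -(pair_big_dep xpredT (fun u i => i != a u) (fun _ _ => 1%N)) /=.
  rewrite (eq_bigr (fun=> l.-1)) => [|u _]; first by rewrite sum_nat_const card_ord.
  rewrite sum1_card; have := cardC1 (a u); rewrite card_ord => <-.
  by apply: eq_card => i; rewrite !inE.
pose N := [set e : B * B | e.2 \in A e.1].
have -> : (k * l * (k * l.-1) = #|N|)%N.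
  rewrite -[RHS]sum1_card (eq_bigl (fun e : B * B => true && (e.2 \in A e.1))); last first.
    by move=> e; rewrite !inE.
  rewrite -(pair_big_dep xpredT (fun x y => y \in A x) (fun _ _ => 1%N)) /=.
  rewrite (eq_bigr (fun=> (k * l.-1)%N)) => [|x _]; last by rewrite sum1_card cA.
  by rewrite sum_nat_const card_prod !card_ord.
pose sw (e : B * B) := (e.2, e.1).
have swI : injective sw by move=> [? ?] [? ?] [-> ->].
rewrite muln2 -addnn.
have swE : #|unlinked s| = #|[set sw e | e in unlinked s]| by rewrite card_imset.
rewrite {2}swE.
have -> : (#|unlinked s| + #|[set sw e | e in unlinked s]| =
   #|unlinked s :|: [set sw e | e in unlinked s]|)%N.
  rewrite cardsU; suff -> : unlinked s :&: [set sw e | e in unlinked s] = set0.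
    by rewrite cards0 subn0.
  apply/setP => e; rewrite !inE; apply/negP => /andP[/andP[e12 _] /imsetP[e']].
  rewrite inE => /andP[e12' _] eE; move: e12; rewrite eE /= => e21.
  by have := ltn_trans e12' e21; rewrite ltnn.
apply: subset_leq_card; apply/subsetP => e; rewrite inE => /orP[|/imsetP[e']].
  rewrite !inE => /andP[e12 ->]; rewrite andbT.
  by apply: contraTneq e12 => ->; rewrite ltnn.
rewrite inE => /andP[e12 nadj] ->; rewrite !inE /= lift_adj_sym nadj andbT.
by apply: contraTneq e12 => ->; rewrite ltnn.
Qed.

(** A connector vertex sees only one vertex of each branch fiber, so it can only serve pairs lying across two fibers. *)
Definition across F : {set B * B} := [set e in F | e.1.1 != e.2.1].

Lemma card_across F : (#|F| <= #|across F| + k * l ^ 2)%N.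
Proof.
rewrite -(cardsID [set e : B * B | e.1.1 != e.2.1] F) leq_add //.
  by apply: subset_leq_card; apply/subsetP => e; rewrite !inE.
pose f (e : B * B) := (e.1.1, (e.1.2, e.2.2)).
rewrite -(card_in_imset (f := f)) => [|[[u a] [u' a']] [[w b] [w' b']]].
  by apply: leq_trans (max_card _) _; rewrite !card_prod !card_ord expnS expn1.
rewrite !inE !negbK /= => /andP[/eqP-> _] /andP[/eqP-> _].
by rewrite /f /= => -[-> -> ->].
Qed.

(** A connector vertex is idle only if its transversal contains no pair of [F]. *)
Lemma mean_idle (F : {set B * B}) v (c : R) : (forall u, br u != v) ->
  (4 * k ^ 3)%:R <= c * (#|across F|%:R / l%:R ^+ 2) ^+ 2 ->
  0 < #|across F|%:R / l%:R ^+ 2 :> R ->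
  mean (fun s => (idle F (neighbours s v))%:R) <= l%:R * c.
Proof.
move=> brv cF F0.
have -> : mean (fun s => (idle F (neighbours s v))%:R) =
   \sum_(j : 'I_l) prob R (fun s => picked F (neighbours s v) j == None).
  rewrite /prob -mean_sum; apply: eq_mean => s; rewrite /idle -sum1_card natr_sum.
  rewrite big_mkcond /=; apply: eq_bigr => j _; rewrite inE; by case: (_ == None).
rewrite -[l in leRHS]card_ord mulr_natl -sumr_const; apply: ler_sum => j _.
have sq : 0 < (#|across F|%:R / l%:R ^+ 2) ^+ 2 :> R by rewrite exprn_gt0.
rewrite -(ler_pM2r sq); apply: le_trans cF.
apply: le_trans (prob_no_seen_pair R v j br_inj F).
rewrite (ler_wpM2r (ltW sq)) //; apply: le_prob => s.
rewrite /picked; case: pickP => // noe _; apply/forall_inP => p _.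
apply/negP => seenF; have := noe (seen br v j s p.1, seen br v j s p.2).
have seen_nb u : seen br v j s u \in neighbours s v j.
  rewrite inE /lift_adj /seen /= brv /=.
  by rewrite (partnerV _ (_ : v != br u)) ?permK // eq_sym.
by move/negP; apply; rewrite /= !seen_nb !andbT.
Qed.

Definition touching vs : {set V * V} := [set p | (p.1 \in vs) || (p.2 \in vs)].

Lemma neighbours_eq s t v :
  (forall u, s (pair_coord (br u) v) = t (pair_coord (br u) v)) -> neighbours s v = neighbours t v.
Proof.
move=> st; apply: funext => j; apply/setP => x; rewrite !inE /lift_adj /=.
congr (_ && (_ == _)); by apply: partner_depends => c /set1P->.
Qed.

(** The pairs waiting when the fiber [v] is treated do not depend on the matchings at [v], so these can be resampled while the waiting pairs are frozen. *)
Lemma mean_idle_total (M : nat) (c : R) vs (F : matchings -> {set B * B}) :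
  0 <= c ->
  (forall F v, (M <= #|F|)%N -> (forall u, br u != v) ->
     mean (fun s => (idle F (neighbours s v))%:R) <= c) ->
  uniq vs -> (forall u, br u \notin vs) -> depends_on (~: touching vs) F ->
  mean (fun s => (idle_total (neighbours s) M (F s) vs)%:R) <= (size vs)%:R * c.
Proof.
move=> c0 cP; elim: vs F => [|v vs IH] F.
  move=> _ _ _; rewrite mul0r (eq_mean (g := fun=> 0)) // mean_cst // card_matchings_gt0 //.
move=> /= /andP[vvs uvs] brvs Fdep.
have brv u : br u != v by have := brvs u; rewrite inE negb_or => /andP[].
have brvs' u : br u \notin vs by have := brvs u; rewrite inE negb_or => /andP[].
rewrite (eq_mean (g := fun s => (if (M <= #|F s|)%N then idle (F s) (neighbours s v) else 0%N)%:R
   + (idle_total (neighbours s) M (serve (F s) (neighbours s v)) vs)%:R)); last first.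
  by move=> s; rewrite -natrD.
rewrite meanD mulrSr mulrDl mul1r addrC lerD //.
  apply: IH => // s t st; congr serve.
    by apply: Fdep => p; rewrite !inE => pvs; apply: st; rewrite !inE; move: pvs;
      rewrite !negb_or => /andP[/andP[_ ->] /andP[_ ->]].
  apply: neighbours_eq => u; apply: st; rewrite !inE /pair_coord.
  by case: ifP => _ /=; rewrite (negPf vvs) (negPf (brvs' u)).
apply: (le_mean_resample (J := touching [:: v])) => [|s]; first exact: card_matchings_gt0.
have Fmix t : F (resample (touching [:: v]) t s) = F s.
  apply: Fdep => p; rewrite !inE !negb_or => /andP[/andP[p1 _] /andP[p2 _]].
  by rewrite resample_notin // !inE (negPf p1) (negPf p2).
have nmix t : neighbours (resample (touching [:: v]) t s) v = neighbours t v.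
  apply: neighbours_eq => u; rewrite resample_in // !inE /pair_coord.
  by case: ifP => _ /=; rewrite eqxx ?orbT.
case: (leqP M #|F s|) => MF.
  rewrite (eq_mean (g := fun t => (idle (F s) (neighbours t v))%:R)); first exact: cP.
  by move=> t; rewrite Fmix nmix MF.
rewrite (eq_mean (g := fun=> 0)) ?mean_cst ?card_matchings_gt0 // => t.
by rewrite Fmix leqNgt MF.
Qed.

End BranchFibers.

(** * Bridges of length three *)

Section Layout.
Variables (R : realFieldType) (n l k D r : nat).
Local Notation V := 'I_n.
Local Notation T := (V * 'I_l)%type.
Local Notation B := ('I_k * 'I_l)%type.
Local Notation matchings := {ffun V * V -> {perm 'I_l}}.

(** The four uses of a fiber: branch fibers, connector fibers, and for each branch fiber [r] left and [r] right reserved fibers. *)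
Definition role := ('I_k + 'I_D + 'I_k * 'I_r + 'I_k * 'I_r)%type.
Variable place : role -> V.
Hypothesis place_inj : injective place.
Implicit Types (s t : matchings) (x y : B) (a : 'I_r).

Definition branch_fiber u := place (inl (inl (inl u))).
Definition connector_fiber d := place (inl (inl (inr d))).
Definition left_fiber x a := place (inl (inr (x.1, a))).
Definition right_fiber x a := place (inr (x.1, a)).

(** The neighbour of the branch vertex [x] in the [a]-th left reserved fiber of its branch fiber. *)
Definition left_end s x a : T := (left_fiber x a, partner s (branch_fiber x.1) (left_fiber x a) x.2).
Definition right_end s x a : T := (right_fiber x a, partner s (branch_fiber x.1) (right_fiber x a) x.2).

Definition bridged s x y a a' := lift_adj s (left_end s x a) (right_end s y a').

Lemma branch_fiber_inj : injective branch_fiber.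
Proof. by move=> u u' /place_inj []. Qed.

(** With the matchings at the branch fibers frozen, the reserved neighbours of [x] and [y] are fixed vertices.  They lie in distinct fibers, so the [#|A| * #|A'|] possible edges between them are independent, each of probability [1 / l]. *)
Lemma prob_no_bridge x y (A A' : {set 'I_r}) :
  prob R (fun s => [forall a in A, forall a' in A', ~~ bridged s x y a a']) <=
  (1 - l%:R^-1) ^+ (#|A| * #|A'|).
Proof.
pose J := [set p : V * V | (p.1 \notin codom branch_fiber) && (p.2 \notin codom branch_fiber)].
have pl c c' : c != c' -> place c != place c' by rewrite (inj_eq place_inj).
have raP x' a : left_fiber x' a \notin codom branch_fiber by apply/negP => /codomP[u /place_inj].
have rbP x' a : right_fiber x' a \notin codom branch_fiber by apply/negP => /codomP[u /place_inj].
apply: (le_mean_resample (J := J)) => [|s]; first exact: card_matchings_gt0.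
have out t u v i : partner (resample J t s) (branch_fiber u) v i = partner s (branch_fiber u) v i.
  apply: partner_depends => c /set1P->; rewrite resample_notin // !inE /pair_coord.
  by case: ifP => _ /=; rewrite codom_f ?andbF.
have inn t x' y' a a' i :
    partner (resample J t s) (left_fiber x' a) (right_fiber y' a') i = partner t (left_fiber x' a) (right_fiber y' a') i.
  apply: partner_depends => c /set1P->; rewrite resample_in // !inE /pair_coord.
  by case: ifP => _ /=; rewrite raP rbP.
pose key (c : 'I_r * 'I_r) := pair_coord (left_fiber x c.1) (right_fiber y c.2).
pose h (c : 'I_r * 'I_r) (q : {perm 'I_l}) : R :=
  (oriented (left_fiber x c.1) (right_fiber y c.2) q (left_end s x c.1).2 != (right_end s y c.2).2)%:R.
rewrite (eq_mean (g := fun t : matchings => \prod_(c <- enum (setX A A')) h c (t (key c)))); last first.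
  move=> t; rewrite big_enum /=; case: forall_inP => [nob|].
    rewrite big1 // => -[a a'] /setXP[/= aA aA'].
    have /forall_inP/(_ a' aA') := nob a aA.
    rewrite /bridged /lift_adj /= pl //= !out inn partnerE /h /= => ->.
    by [].
  move=> nob; apply/esym/eqP; apply/prodf_eq0.
  have /forall_inPn[a aA /forall_inPn[a' aA' nb]] : ~~ [forall a in A, forall a' in A', ~~ bridged (resample J t s) x y a a'].
    by apply/negP => /forall_inP.
  exists (a, a'); first by rewrite inE /= aA aA'.
  move: nb; rewrite negbK /bridged /lift_adj /= => /andP[_].
  by rewrite !out inn partnerE /h /= => ->.
(* The left and the right reserved fibers differ, so distinct couples of reserved fibers have distinct coordinates. *)
rewrite (mean_prod (key := key)) ?card_perm_gt0 ?enum_uniq //; last first.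
  move=> [a a'] [b b'] _ _; rewrite /key /pair_coord /=.
  by case: ifP => _; case: ifP => _ [] /place_inj e1 /place_inj e2;
    move: e1 e2 => // [->] [->].
rewrite (eq_bigr (fun=> 1 - l%:R^-1)) => [|c _].
  by rewrite big_const_seq count_predT -cardE cardsX iter_mulr_1.
rewrite -[l%:R^-1](prob_oriented R (left_fiber x c.1) (right_fiber y c.2) (left_end s x c.1).2 (right_end s y c.2).2).
rewrite -[LHS]/(prob R (fun q => _ != _)) probC ?card_perm_gt0 //; congr (1 - _).
by apply: eq_prob => q /=; rewrite negbK.
Qed.

(** Union bound over the pairs of branch vertices and of subsets of ['I_r]. *)
Lemma prob_not_well_linked (c : R) : 
  (forall N, (r * r <= 4 * N)%N -> (1 - l%:R^-1) ^+ N <= c) ->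
  prob R (fun s => ~~ `[< well_linked (bridged s) >]) <=
    ((k * l) ^ 2 * 4 ^ r)%:R * c.
Proof.
move=> cN; pose I := ((B * B) * ({set 'I_r} * {set 'I_r}))%type.
pose S := [pred i : I | (r <= #|i.2.1| * 2)%N && (r <= #|i.2.2| * 2)%N].
pose bad (i : I) s := [forall a in i.2.1, forall a' in i.2.2, ~~ bridged s i.1.1 i.1.2 a a'].
have c0 : 0 <= c.
  apply: le_trans (cN (r * r)%N _); last by rewrite leq_pmull.
  rewrite exprn_ge0 // subr_ge0; case: (l) => [|m]; first by rewrite invr0 ler01.
  by rewrite invf_le1 ?ler1n ?ltr0n.
apply: (@le_trans _ _ (prob R (fun s => [exists i in S, bad i s]))).
  apply: le_prob => s; apply: contraR => /exists_inPn nobad; apply/asboolP.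
  move=> x y A A' rA rA'.
  have := nobad ((x, y), (A, A')); rewrite inE /= rA rA' => /(_ isT)/forall_inPn[a aA].
  move=> /forall_inPn[a' aA']; rewrite negbK => ok; by exists a, a'.
apply: le_trans (prob_exists _ _ _) _.
apply: (@le_trans _ _ (\sum_(i : I) c)); last first.
  rewrite sumr_const -[_ *+ _]mulr_natl ler_wpM2r // ler_nat.
  have -> : #|{: I}| = (#|{: B * B}| * (#|{: {set 'I_r}}| * #|{: {set 'I_r}}|))%N.
    by rewrite !card_prod.
  rewrite -!cardsT -!powersetT !card_powerset !cardsT !card_prod !card_ord.
  by rewrite -expnMn expnS expn1.
rewrite [leLHS]big_mkcond; apply: ler_sum => -[[x y] [A A']] _.
case: ifP => // /andP[/= rA rA'].
apply: le_trans (prob_no_bridge x y A A') (cN _ _).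
by have := leq_mul rA rA'; rewrite mulnACA [(2 * 2)%N]/= mulnC.
Qed.

End Layout.

(** * Assembling the topological clique *)

Section IncreasingEnum.
Local Open Scope nat_scope.

(** The pairs of [unlinked] are ordered by [enum_rank], so the branch vertices of the clique have to be listed in that order. *)
Lemma increasing_enum (T : finType) (A : {set T}) :
  exists b : 'I_#|A| -> T, (forall i, b i \in A) /\
    forall i j : 'I_#|A|, i < j -> enum_rank (b i) < enum_rank (b j).
Proof.
pose leT := relpre (@enum_rank T) (fun i j : 'I_#|T| => i <= j).
have tot : total leT by move=> x y; apply: leq_total.
pose e := sort leT (enum A).
have se : size e = #|A| by rewrite size_sort -cardE.
have ue : uniq e by rewrite sort_uniq enum_uniq.
exists (fun i => nth (enum_val i) e i); split => [i|i j ij].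
  by rewrite -mem_enum -(mem_sort leT) mem_nth // se.
have je : j < size e by rewrite se.
have ie : i < size e by rewrite se.
rewrite (set_nth_default (enum_val j)) // ltn_neqAle; apply/andP; split.
  by rewrite val_eqE (inj_eq enum_rank_inj) nth_uniq // neq_ltn ij.
apply: (sorted_leq_nth (leT := leT)) => //.
- by move=> y x z; apply: leq_trans.
- by move=> x; apply: leqnn.
- exact: sort_sorted.
- exact: ltnW.
Qed.

End IncreasingEnum.

Section Assembly.
Local Open Scope nat_scope.
Variables (n l k D r : nat).
Local Notation V := 'I_n.
Local Notation T := (V * 'I_l)%type.
Local Notation B := ('I_k * 'I_l)%type.
Local Notation matchings := {ffun V * V -> {perm 'I_l}}.
Variable place : role k D r -> V.
Hypothesis place_inj : injective place.
Local Notation br := (branch_fiber place).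
Local Notation gr := (connector_fiber place).
Local Notation branch := (branch br).
Local Notation nbrs := (neighbours br).
Variable s : matchings.

Definition connectors : seq V := [seq gr d | d <- enum 'I_D].

Definition leftover : {set B * B} := run (nbrs s) (unlinked br s) connectors.

Definition few_leftover : {set B} :=
  [set x | (#|[set e in leftover | e.1 == x]| * 2 <= r) &&
           (#|[set e in leftover | e.2 == x]| * 2 <= r)].

(** Double counting: each discarded vertex lies in more than [r / 2] leftover pairs on one side. *)
Lemma card_few_leftover : r * (k * l) <= r * #|few_leftover| + 4 * #|leftover|.
Proof.
have half (p : B * B -> B) :
    r * #|[set x | r < #|[set e in leftover | p e == x]| * 2]| <= 2 * #|leftover|.
  rewrite mulnC -sum_nat_const -[#|leftover|]sum1_card (partition_big p xpredT) //= big_distrr /=.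
  rewrite [leqLHS]big_mkcond; apply: leq_sum => x _; case: ifP => //.
  rewrite inE => /ltnW lt; apply: leq_trans lt _; rewrite mulnC leq_mul2l /=.
  by rewrite -sum1_card; apply: eq_leq; apply: eq_bigl => e; rewrite inE.
have := half fst; have := half snd; set X1 := [set x | _]; set X2 := [set x | _] => h2 h1.
have : k * l <= #|few_leftover| + (#|X1| + #|X2|).
  have -> : k * l = #|{: B}| by rewrite card_prod !card_ord.
  rewrite -cardsT; apply: leq_trans (leq_trans (leq_card_setU few_leftover (X1 :|: X2)).1 _).
    apply: subset_leq_card; apply/subsetP => x _; rewrite !inE.
    by case: leqP => //= _; case: leqP.
  by rewrite leq_add2l (leq_card_setU X1 X2).1.
move/(leq_mul (leqnn r)); rewrite !mulnDr.
by move: (r * _) (r * _) (r * _) (r * _) h1 h2 => *; lia.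
Qed.

(** A pair of kept branch vertices is joined by an edge, by the connector vertex that serves it, or by a bridge through reserved fibers.  An internal vertex determines its pair: a connector vertex by the assignment, a reserved vertex by its owner and by the choice of [disjoint_links]. *)
Lemma clique_few_leftover (z : 'I_r) : well_linked (bridged place s) ->
  has_topological_clique (lift_of s) #|few_leftover|.
Proof.
move=> WL; pose G := few_leftover.
pose L := enum [set e in leftover | (e.1 \in G) && (e.2 \in G)].
have countL (p : B * B -> B) (q : B) :
    (q \in G -> #|[set e in leftover | p e == q]| * 2 <= r) ->
    (forall e, e \in L -> p e \in G) ->
    count (fun e => p e == q) L * 2 <= r.
  move=> qd pG; case: (boolP (q \in G)) => [qG|qG].
    apply: leq_trans (qd qG); rewrite leq_mul2r /= -size_filter.
    have <- : size (enum [set e in leftover | p e == q]) = #|[set e in leftover | p e == q]|.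
      by rewrite -cardE.
    apply: uniq_leq_size; first by rewrite filter_uniq ?enum_uniq.
    by move=> e; rewrite mem_filter !mem_enum !inE => /andP[-> /andP[-> _]].
  rewrite (eq_in_count (a2 := pred0)) ?count_pred0 // => e /pG eG.
  by apply/negbTE; apply: contraNneq qG => <-.
have LG e : e \in L -> e.1 \in G /\ e.2 \in G.
  by rewrite mem_enum inE => /and3P[].
have [||f fP] := disjoint_links z WL (enum_uniq _ : uniq L).
- by move=> x; apply: countL => [|e /LG[]//]; rewrite inE => /andP[].
- by move=> x; apply: countL => [|e /LG[]//]; rewrite inE => /andP[].
have gr_inj : injective gr by move=> d d' /place_inj [].
have uc : uniq connectors by rewrite map_inj_uniq // enum_uniq.
have [asg asgP] := run_assignment (nbrs s) (unlinked br s) uc.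
have [b [bG b_lt]] := increasing_enum G.
pose via (e : B * B) (w : V * 'I_l) :=
  [&& w.1 \in connectors, asg w.1 w.2 == Some e, e.1 \in nbrs s w.1 w.2 & e.2 \in nbrs s w.1 w.2].
(* The internal vertices of the path that joins the ends of [e]. *)
pose P (e : B * B) : seq T :=
  if e \in leftover then [:: left_end place s e.1 (f e).1; right_end place s e.2 (f e).2]
  else if lift_adj s (branch e.1) (branch e.2) then [::]
  else if [pick w | via e w] is Some w then [:: w] else [::].
have PP e w : e.1 \in G -> e.2 \in G -> w \in P e ->
    [\/ via e w, e \in L /\ w = left_end place s e.1 (f e).1 |
        e \in L /\ w = right_end place s e.2 (f e).2].
  move=> e1 e2; rewrite /P; case: ifP => eL.
    have eL' : e \in L by rewrite mem_enum inE eL e1 e2.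
    by rewrite !inE => /orP[]/eqP->; [apply: Or32|apply: Or33].
  by case: ifP => // _; case: pickP => // w' vw; rewrite inE => /eqP->; apply: Or31.
exists (branch \o b), (fun i j => P (b i, b j)).
have b_inj : injective b.
  move=> i j bij; case: (ssrnat.ltngtP i j) => [/b_lt|/b_lt|/val_inj //];
    by rewrite bij ltnn.
split => /=.
- exact: inj_comp (branch_inj (branch_fiber_inj place_inj)) b_inj.
- move=> i j ij; rewrite /P /=; case: ifPn => eL.
    have eL' : (b i, b j) \in L by rewrite mem_enum inE eL /= !bG.
    have [ok _] := fP _ eL'.
    rewrite /= !adj_lift_of andbT; apply/and3P; split=> //.
      by rewrite /lift_adj /= eqxx andbT (inj_eq place_inj).
    by rewrite lift_adj_sym /lift_adj /= eqxx andbT (inj_eq place_inj).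
  case: ifPn => nadj; first by rewrite /= adj_lift_of nadj.
  have eF : (b i, b j) \in unlinked br s by rewrite inE /= nadj b_lt.
  have [|v [h [vc ve e1 e2]]] := asgP (b i, b j); first by rewrite inE eL.
  case: pickP => [[u a] /and4P[_ _]|/(_ (v, h))]; last by rewrite /via vc ve eqxx e1 e2.
  by rewrite !inE /= !adj_lift_of andbT => -> /=; rewrite lift_adj_sym.
- move=> i j ij; rewrite /P; case: ifP => _.
    by rewrite /= inE andbT xpair_eqE (inj_eq place_inj).
  by case: ifP => // _; case: pickP.
- move=> i j h ij; apply/negP => /PP[]; rewrite ?bG //.
  + by move=> /and4P[/mapP[d _ /place_inj]].
  + by case=> _ [/place_inj].
  + by case=> _ [/place_inj].
- move=> i j i' j' ij ij' ne w wP; apply/negP => wP'.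
  have neb : (b i, b j) != (b i', b j') by apply: contra ne => /eqP[/b_inj -> /b_inj ->].
  have {wP}[/and4P[/mapP[d _ wd] /eqP we _ _]|[eL we]|[eL we]] := PP (b i, b j) w (bG i) (bG j) wP;
  have {wP'}[/and4P[/mapP[d' _ wd'] /eqP we' _ _]|[eL' we']|[eL' we']] := PP (b i', b j') w (bG i') (bG j') wP'.
  + by move: neb; rewrite we in we'; case: we' => -> ->; rewrite eqxx.
  + by move: wd; rewrite we' => /place_inj.
  + by move: wd; rewrite we' => /place_inj.
  + by move: wd'; rewrite we => /place_inj.
  + move: we'; rewrite we => -[/place_inj[e1 e2] e3].
    have e4 : b i = b i'.
      move: e3; rewrite /= /left_fiber /= e1 e2 => /perm_inj e3.
      by rewrite [LHS]surjective_pairing [RHS]surjective_pairing e1 e3.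
    have [_ /(_ _ eL' neb)[/(_ e4)]] := fP _ eL.
    by rewrite e2.
  + by move: we'; rewrite we => -[/place_inj].
  + by move: wd'; rewrite we => /place_inj.
  + by move: we'; rewrite we => -[/place_inj].
  + move: we'; rewrite we => -[/place_inj[e1 e2] e3].
    have e4 : b j = b j'.
      move: e3; rewrite /= /right_fiber /= e1 e2 => /perm_inj e3.
      by rewrite [LHS]surjective_pairing [RHS]surjective_pairing e1 e3.
    have [_ /(_ _ eL' neb)[_ /(_ e4)]] := fP _ eL.
    by rewrite e2.
Qed.

End Assembly.

(** * The lower tail *)

Lemma exists_injection (A : finType) n : (#|A| <= n)%N ->
  exists f : A -> 'I_n, injective f.
Proof.
move=> An; exists (fun x => widen_ord An (enum_rank x)) => x y.
by move=> /(congr1 val) /= /val_inj /enum_rank_inj.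
Qed.

Section LowerTail.
Variables (R : realType) (n l k D r M : nat) (mu theta : R).
Hypotheses (l_gt0 : (0 < l)%N) (k_gt0 : (0 < k)%N) (D_gt0 : (0 < D)%N) (r_gt0 : (0 < r)%N).
Hypothesis fits : (k + D + 2 * (k * r) <= n)%N.
Hypotheses (mu_gt0 : 0 < mu) (mu_k : 2 <= mu * k%:R).
Hypothesis mu_M : mu * (k * l)%:R ^+ 2 <= M%:R.
Hypotheses (theta_gt0 : 0 < theta).
Hypothesis enough : (k * (k * l.-1))%:R <= 2 * (1 - theta) * D%:R :> R.
Local Notation V := 'I_n.
Local Notation matchings := {ffun V * V -> {perm 'I_l}}.

(** At least [mu * (k * l) ^ 2] pairs are waiting, and at most half as many lie inside a single fiber, so a vertex expects to see at least [mu / 2 * k ^ 2] waiting pairs. *)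
Lemma mean_idle_bound (br : 'I_k -> V) (F : {set ('I_k * 'I_l) * ('I_k * 'I_l)}) (v : V) :
  injective br -> (M <= #|F|)%N -> (forall u, br u != v) ->
  mean (fun s : matchings => (idle F (neighbours br s v))%:R) <= l%:R * (16 / (mu ^+ 2 * k%:R)).
Proof.
move=> br_inj MF brv.
have k0 : 0 < k%:R :> R by rewrite ltr0n.
have l0 : 0 < l%:R :> R by rewrite ltr0n.
have acr : mu / 2 * k%:R ^+ 2 <= #|across F|%:R / l%:R ^+ 2.
  rewrite ler_pdivlMr ?exprn_gt0 //.
  have : M%:R <= #|across F|%:R + k%:R * l%:R ^+ 2 :> R.
    by rewrite -natrX -natrM -natrD ler_nat (leq_trans MF) // card_across.
  move: mu_M; rewrite natrM => m1 m2.
  have m3 : 2 * (k%:R * l%:R ^+ 2) <= mu * k%:R * (k%:R * l%:R ^+ 2).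
    by rewrite ler_wpM2r // mulr_ge0 // exprn_ge0.
  have -> : mu / 2 * k%:R ^+ 2 * l%:R ^+ 2 =
     mu * (k%:R * l%:R) ^+ 2 - (mu * k%:R * (k%:R * l%:R ^+ 2)) / 2 by field.
  lra.
have pos : 0 < mu / 2 * k%:R ^+ 2 by rewrite mulr_gt0 ?divr_gt0 ?exprn_gt0.
apply: mean_idle => //; last exact: lt_le_trans acr.
have -> : (4 * k ^ 3)%:R = 16 / (mu ^+ 2 * k%:R) * (mu / 2 * k%:R ^+ 2) ^+ 2 :> R.
  rewrite natrM natrX; field; by rewrite !gt_eqF.
rewrite ler_wpM2l //; first by rewrite divr_ge0 // mulr_ge0 // ?sqr_ge0 ?ltW.
by rewrite lerXn2r // nnegrE ltW // (lt_le_trans pos).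
Qed.

(** The two terms bound the probability that at least [M] pairs are left over and the probability that the reserved fibers are not well linked.  In the first event, counting vertices forces a proportion [theta] of the connector vertices to be idle. *)
Lemma prob_hajos_lt (h : nat) : (r * h + 4 * M <= r * (k * l))%N ->
  prob R (fun s : matchings => (hajos (lift_of s) < h)%N) <=
    16 / (mu ^+ 2 * k%:R * theta) +
    ((k * l) ^ 2 * 4 ^ r)%:R * expR (- (r%:R ^+ 2 / (4 * l%:R))).
Proof.
move=> hM.
have [place place_inj] : exists place : role k D r -> V, injective place.
  apply: exists_injection; rewrite !card_sum card_prod !card_ord; lia.
pose brp := branch_fiber place; have brI : injective brp := branch_fiber_inj place_inj.
pose lo (s : matchings) := leftover place s.
have k0 : 0 < k%:R :> R by rewrite ltr0n.
have l0 : 0 < l%:R :> R by rewrite ltr0n.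
have D0 : 0 < D%:R :> R by rewrite ltr0n.
have le1 : prob R (fun s : matchings => (hajos (lift_of s) < h)%N) <=
   prob R (predU (fun s : matchings => (M <= #|lo s|)%N)
    (fun s => ~~ `[< well_linked (bridged place s) >])).
  apply: le_prob => s /=; apply: contraLR; rewrite negb_or negbK -ltnNge -leqNgt.
  move=> /andP[loM /asboolP WL].
  apply: leq_trans (hajos_max (clique_few_leftover place_inj (Ordinal r_gt0) WL)).
  rewrite -(leq_pmul2l r_gt0); have := card_few_leftover place s; rewrite -/(lo s).
  move: hM loM; move: (r * h)%N (r * _)%N #|lo s| (r * _)%N => a b c d; lia.
apply: (le_trans le1); apply: le_trans (probU _ _ _) _; apply: lerD; last first.
  apply: prob_not_well_linked => // N rN.
  apply: (@le_trans _ _ (expR (- l%:R^-1) ^+ N)).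
    rewrite lerXn2r ?nnegrE ?expR_ge0 ?expR_ge1Dx // subr_ge0 invf_le1 //.
    by rewrite ler1n.
  rewrite -expRM_natr ler_expR mulNr lerN2 [leRHS]mulrC ler_pdivrMr ?mulr_gt0 //.
  have -> : N%:R / l%:R * (4 * l%:R) = (4 * N)%:R :> R by rewrite natrM; field; rewrite gt_eqF.
  by rewrite -natrX ler_nat expnS expn1.
pose it (s : matchings) := idle_total (neighbours brp s) M (unlinked brp s) (connectors place).
have gr_inj : injective (connector_fiber place) by move=> d d' /place_inj [].
have uc : uniq (connectors place) by rewrite map_inj_uniq // enum_uniq.
have sc : size (connectors place) = D by rewrite size_map size_enum_ord.
apply: (@le_trans _ _ (mean (fun s => (it s)%:R) / (theta * (D%:R * l%:R)))).
  apply: mean_markov => [|s|s Mlo]; rewrite ?mulr_gt0 ?ler0n //.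
  have := card_run (@neighbours_disjoint _ _ _ brp s) Mlo.
  rewrite -/(it s) sc -/(lo s) => c1.
  have c2 := card_unlinked brI s.
  have : (D * l)%:R <= #|unlinked brp s|%:R + (it s)%:R :> R.
    by rewrite -natrD ler_nat (leq_trans _ c1) // leq_addl.
  have : #|unlinked brp s|%:R * 2 <= l%:R * (k * (k * l.-1))%:R :> R.
    rewrite -[2]/(2%:R) -!natrM ler_nat (leq_trans c2) //.
    by apply: eq_leq; rewrite -!mulnA mulnCA.
  have : l%:R * (k * (k * l.-1))%:R <= l%:R * (2 * (1 - theta) * D%:R) :> R.
    by rewrite ler_wpM2l.
  rewrite natrM => e1 e2 e3; nra.
rewrite ler_pdivrMr ?mulr_gt0 //.
have -> : 16 / (mu ^+ 2 * k%:R * theta) * (theta * (D%:R * l%:R)) =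
   (size (connectors place))%:R * (l%:R * (16 / (mu ^+ 2 * k%:R))).
  by rewrite sc; field; rewrite !gt_eqF.
apply: mean_idle_total => //.
- by rewrite !mulr_ge0 // invr_ge0 mulr_ge0 ?sqr_ge0.
- by move=> F v MF brv; apply: mean_idle_bound.
- by move=> u; apply/negP => /mapP[d _ /place_inj].
- move=> s t st; apply/setP => e; rewrite !inE /lift_adj /=; congr (_ && ~~ (_ && (_ == _))).
  apply: partner_depends => c /set1P->; apply: st.
  have nc u : brp u \notin connectors place by apply/negP => /mapP[d _ /place_inj].
  by rewrite !inE /pair_coord; case: ifP => _ /=; rewrite !(negPf (nc _)).
Qed.

End LowerTail.

(** * Asymptotics *)

Section Asymptotics.
Variable R : realType.
Implicit Types (n l : nat).

(** From [1 + y <= expR y] at [y = c * x / 3], cubed. *)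
Lemma sqr_mul_expRN (c x : R) : 0 < c -> 0 < x ->
  x ^+ 2 * expR (- (c * x)) <= 27 / (c ^+ 3 * x).
Proof.
move=> c0 x0.
have cx : 0 < c * x by exact: mulr_gt0.
have e3 : (c * x / 3) ^+ 3 <= expR (c * x).
  set y := c * x / 3; have -> : c * x = y * 3%:R by rewrite /y; field.
  have y0 : 0 <= y by rewrite divr_ge0 ?ltW.
  rewrite expRM_natr lerXn2r ?nnegrE ?expR_ge0 //.
  by apply: le_trans (expR_ge1Dx _); rewrite lerDr.
rewrite expRN ler_pdivrMr ?expR_gt0 //.
apply: le_trans (ler_wpM2l _ e3); last by rewrite divr_ge0 // mulr_ge0 ?exprn_ge0 ?ltW.
rewrite le_eqVlt; apply/orP; left; apply/eqP; field.
by rewrite !gt_eqF.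
Qed.

Lemma hajos_scale_sqr n l : (2 <= l)%N ->
  hajos_scale R n l ^+ 2 * (1 - l%:R^-1) = 2 * n%:R * l%:R.
Proof.
move=> l2; have t1 : 0 < 1 - l%:R^-1 :> R.
  by rewrite subr_gt0 invf_lt1 ?ltr1n ?ltr0n // ltnW.
rewrite sqr_sqrtr; first by rewrite divfK // gt_eqF.
by rewrite divr_ge0 ?mulr_ge0 // ltW.
Qed.

(** With [m] just above [(1 + delta) * hajos_scale R n l], the edge density required by [clique_edges] exceeds [1 / l] by a constant [eps], and [a = eps / 4] makes the bound of [prob_hajos_ge] smaller than [(m ^ 2 * expR (- (c * m))) ^ m]. *)
Lemma upper_tail (delta eta : R) : 0 < delta -> 0 < eta ->
  exists K0 : nat, forall n l, (2 <= l)%N -> (K0 * l <= n)%N ->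
    prob R (fun s : {ffun 'I_n * 'I_n -> {perm 'I_l}} =>
      (1 + delta) * hajos_scale R n l < (hajos (lift_of s))%:R) <= eta.
Proof.
move=> d0 eta0.
pose rho : R := (1 + delta) ^- 2; pose eps := (1 - rho) / 4.
have d1 : 0 < (1 + delta) ^+ 2 by rewrite exprn_gt0 // addr_gt0.
have rho0 : 0 < rho by rewrite invr_gt0.
have rho1 : rho < 1 by rewrite invf_lt1 //; nra.
have eps0 : 0 < eps by rewrite /eps; lra.
have eps1 : eps <= 1 / 4 by rewrite /eps; lra.
pose c := eps ^+ 2 / 16; have c0 : 0 < c by rewrite divr_gt0 // exprn_gt0.
pose e1 := Num.min eta 1.
have e10 : 0 < e1 by rewrite lt_min eta0 ltr01.
pose m0 : R := 2 + 1 / eps + 27 / (c ^+ 3 * e1).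
have p1 : 0 <= 1 / eps by rewrite divr_ge0 ?ltW.
have p2 : 0 <= 27 / (c ^+ 3 * e1) by rewrite divr_ge0 // mulr_ge0 ?exprn_ge0 ?ltW.
have m02 : 2 <= m0 by rewrite /m0; lra.
exists (Num.truncn (m0 ^+ 2)).+1 => n l l2 nl.
pose S := hajos_scale R n l; pose m := (Num.truncn ((1 + delta) * S)).+1.
have S0 : 0 <= S by rewrite sqrtr_ge0.
have mS : (1 + delta) * S < m%:R by exact: truncnS_gt.
have S2 := hajos_scale_sqr n l2; rewrite -/S in S2.
pose t : R := l%:R^-1.
have L0 : 0 < l%:R :> R by rewrite ltr0n; apply: leq_trans l2.
have L2 : 2 <= l%:R :> R by rewrite ler_nat.
have t0 : 0 < t by rewrite invr_gt0.
have t12 : t <= 1 / 2 by rewrite /t div1r lef_pV2 ?posrE //.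
pose N : R := (n * l)%:R.
have NE : 2 * N = S ^+ 2 * (1 - t) by rewrite S2 /N natrM mulrA.
have m_gt0 : 0 < m%:R :> R by rewrite ltr0n.
have S2m : S ^+ 2 <= rho * m%:R ^+ 2.
  have d1S : 0 <= (1 + delta) * S by rewrite mulr_ge0 // addr_ge0 // ltW.
  by rewrite /rho mulrC ler_pdivlMr // -exprMn mulrC lerXn2r ?nnegrE // ltW.
have m02n : m0 ^+ 2 <= n%:R.
  apply: (@le_trans _ _ ((Num.truncn (m0 ^+ 2)).+1%:R)); first exact/ltW/truncnS_gt.
  by rewrite ler_nat; apply: leq_trans nl; rewrite leq_pmulr // ltnW.
have N2m : 2 * N <= m%:R ^+ 2 * (rho * (1 - t)).
  have t1 : 0 <= 1 - t by lra.
  by rewrite NE mulrA [m%:R ^+ 2 * rho]mulrC ler_wpM2r.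
have Nm : 2 * N <= m%:R ^+ 2.
  by apply: le_trans N2m _; rewrite ler_piMr ?exprn_ge0 //; nra.
have m0m : m0 <= m%:R.
  have m00 : 0 <= m0 by lra.
  rewrite -(@ler_pXn2r _ 2%N) ?nnegrE ?ler0n //.
  apply: le_trans m02n _; apply: le_trans Nm; rewrite /N natrM mulrCA ler_peMr //; lra.
have m_eps : 1 <= m%:R * eps.
  by rewrite -ler_pdivrMr //; apply: le_trans m0m; rewrite /m0; lra.
have mm1 : (m * m.-1)%:R = m%:R ^+ 2 - m%:R :> R by rewrite /m natrM /= mulrSr; ring.
(* The density of edges needed inside a clique exceeds [t = 1 / l] by [eps]. *)
have K2 : m%:R ^+ 2 * (t + eps) <= m%:R ^+ 2 - m%:R - 2 * N.
  have h1 : m%:R <= m%:R ^+ 2 * eps by rewrite expr2 -mulrA ler_peMr.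
  have h2 : rho * (1 - t) <= 1 - t - 2 * eps by rewrite /eps; nra.
  have h3 : 2 * N <= m%:R ^+ 2 * (1 - t - 2 * eps).
    by apply: le_trans N2m _; rewrite ler_wpM2l // exprn_ge0.
  nra.
pose a := eps / 4.
have a01 : 0 <= a <= 1 by rewrite /a; apply/andP; split; lra.
apply: (@le_trans _ _ (prob R (fun s : {ffun 'I_n * 'I_n -> {perm 'I_l}} => (m <= hajos (lift_of s))%N))).
  apply: le_prob => s hs; rewrite /m -(ltr_nat R).
  apply: le_lt_trans hs; rewrite truncn_le; by rewrite mulr_ge0 // addr_ge0 ?ltW.
apply: le_trans (prob_hajos_ge n l m a01) _; rewrite mm1 -/N.
have me : m%:R ^+ 2 * expR (- (c * m%:R)) <= e1.
  apply: le_trans (sqr_mul_expRN c0 m_gt0) _.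
  have c3 : 0 < c ^+ 3 by rewrite exprn_gt0.
  have : 27 / (c ^+ 3 * e1) <= m%:R by apply: le_trans m0m; rewrite /m0; lra.
  have q1 : 0 < c ^+ 3 * e1 by exact: mulr_gt0.
  have q2 : 0 < c ^+ 3 * m%:R by exact: mulr_gt0.
  rewrite (ler_pdivrMr _ _ q1) (ler_pdivrMr _ _ q2).
  by have -> : e1 * (c ^+ 3 * m%:R) = m%:R * (c ^+ 3 * e1) by ring.
apply: (@le_trans _ _ ((m%:R ^+ 2 * expR (- (c * m%:R))) ^+ m)); last first.
  apply: (@le_trans _ _ (e1 ^+ m)).
    by rewrite lerXn2r // nnegrE ?mulr_ge0 ?exprn_ge0 ?expR_ge0 // ltW.
  apply: (@le_trans _ _ e1); last by rewrite ge_min lexx.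
  rewrite /m exprS; apply: ler_piMr; first exact: ltW.
  by apply: exprn_ile1; [exact: ltW|rewrite ge_min lexx orbT].
rewrite [leRHS]exprMn; apply: ler_pM.
- by rewrite exprn_ge0.
- by rewrite divr_ge0 ?expR_ge0.
- rewrite lerXn2r ?nnegrE ?exprn_ge0 //.
  apply: le_trans Nm; rewrite mulr_natl mulr2n lerDl //.
- rewrite -expRM_natr -expRN -expRD ler_expR.
  have -> : a * m%:R ^+ 2 / (2 * l%:R) = m%:R ^+ 2 * (a * t) / 2.
    rewrite /t; field; by rewrite gt_eqF.
  have aa : 0 <= a - a ^+ 2 by rewrite /a; nra.
  have := ler_wpM2l aa K2.
  have -> : - (c * m%:R) * m%:R = - (m%:R ^+ 2 * c) by ring.
  have m2 : 0 <= m%:R ^+ 2 :> R by rewrite exprn_ge0.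
  have : a * t + 2 * c <= (a - a ^+ 2) * (t + eps).
    rewrite /c /a; nra.
  move=> /(ler_wpM2l m2); nra.
Qed.

End Asymptotics.

Section LowerAsymptotics.
Variable R : realType.
Implicit Types (n l : nat).

(** Here [r] is of order [k * l], so the exponent [r ^ 2 / (4 * l)] is a large multiple of [r] and absorbs both [4 ^ r] and [(k * l) ^ 2]. *)
Lemma bridge_term (A eta : R) (k l r : nat) :
  0 < A -> 0 < eta -> (0 < l)%N -> (0 < k)%N ->
  A * (k * l)%:R / 4 <= r%:R -> 48 <= A * k%:R ->
  (4 / A) ^+ 2 * 27 / eta <= A * k%:R / 4 ->
  ((k * l) ^ 2 * 4 ^ r)%:R * expR (- (r%:R ^+ 2 / (4 * l%:R))) <= eta.
Proof.
move=> A0 eta0 l_gt0 k_gt0 rlow kd keta.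
have L1 : 1 <= l%:R :> R by rewrite ler1n.
have L0 : 0 < l%:R :> R by lra.
have K0 : 0 < k%:R :> R by rewrite ltr0n.
rewrite natrM in rlow.
have Ak0 : 0 < A * k%:R by exact: mulr_gt0.
have Akl : A * k%:R <= A * (k%:R * l%:R) by rewrite mulrA ler_peMr // ltW.
have r0 : 0 < r%:R :> R by lra.
have r0' : 0 <= r%:R :> R by exact: ltW.
have l40 : 0 < 4 * l%:R :> R by lra.
have rl : 3 <= r%:R / (4 * l%:R) :> R by rewrite (ler_pdivlMr _ _ l40); nra.
have q0 : 0 <= 4 / A by rewrite divr_ge0 // ltW.
apply: (@le_trans _ _ ((4 / A) ^+ 2 * (r%:R ^+ 2 * expR (- (1 * r%:R))))).
  rewrite natrM !natrX mulrA -[leLHS]mulrA; apply: ler_pM.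
  - by rewrite exprn_ge0.
  - by rewrite mulr_ge0 ?expR_ge0 ?exprn_ge0.
  - rewrite -exprMn; apply: lerXn2r; rewrite ?nnegrE ?ler0n //; first exact: mulr_ge0.
    have -> : 4 / A * r%:R = r%:R * 4 / A by field; rewrite gt_eqF.
    by rewrite (ler_pdivlMr _ _ A0) natrM; lra.
  - have e4 : 4 <= expR 2 :> R.
      have -> : (2 : R) = 1 * 2%:R by ring.
      rewrite expRM_natr; have := expR_ge1Dx (1 : R); nra.
    apply: (@le_trans _ _ (expR 2 ^+ r * expR (- (r%:R ^+ 2 / (4 * l%:R))))).
      rewrite ler_wpM2r ?expR_ge0 //; apply: lerXn2r => //;
        by rewrite nnegrE ?expR_ge0.
    rewrite -expRM_natr -expRD ler_expR mul1r.
    have -> : r%:R ^+ 2 / (4 * l%:R) = r%:R * (r%:R / (4 * l%:R)) :> R by rewrite expr2 -mulrA.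
    nra.
apply: (@le_trans _ _ ((4 / A) ^+ 2 * (27 / (1 ^+ 3 * r%:R)))).
  apply: ler_wpM2l; first by rewrite exprn_ge0.
  by apply: sqr_mul_expRN; rewrite ?ltr01.
rewrite expr1n mul1r mulrA (ler_pdivrMr _ _ r0) [leRHS]mulrC -(ler_pdivrMr _ _ eta0).
apply: (le_trans keta); apply: le_trans rlow; lra.
Qed.

Lemma exists_nat_between (a b : R) : 0 <= a -> a + 1 <= b ->
  exists m : nat, a < m%:R /\ m%:R <= b.
Proof.
move=> a0 ab; exists (Num.truncn a).+1; split; first exact: truncnS_gt.
by apply: le_trans ab; rewrite mulrSr lerD2r truncn_le.
Qed.

(** The number of non-adjacent pairs is at most a proportion [1 - 8 * A] of the number of connector vertices. *)
Lemma connectors_suffice (A x L n k D : R) :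
  0 < A -> 64 * A < 1 -> 2 <= L -> 0 <= n -> 0 <= k -> k <= (1 - 16 * A) * x ->
  x ^+ 2 * (L - 1) = 2 * n -> (1 - 8 * A) * n <= D ->
  k * (k * (L - 1)) <= 2 * (1 - 8 * A) * D.
Proof.
move=> A0 A1 L2 n0 k0 kx x2 D1.
have L1 : 0 <= L - 1 by lra.
have A8 : 0 <= 2 * (1 - 8 * A) by lra.
apply: le_trans (ler_wpM2l A8 D1).
have -> : 2 * (1 - 8 * A) * ((1 - 8 * A) * n) = (1 - 8 * A) ^+ 2 * (x ^+ 2 * (L - 1)).
  by rewrite x2; ring.
have -> : k * (k * (L - 1)) = k ^+ 2 * (L - 1) by ring.
rewrite mulrA -exprMn; apply: ler_wpM2r => //.
have x0 : 0 <= x by clear -A0 A1 k0 kx; nra.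
apply: lerXn2r; rewrite ?nnegrE //; first by rewrite mulr_ge0 //; lra.
by apply: (le_trans kx); apply: ler_wpM2r => //; lra.
Qed.

(** The discarded branch vertices are at most a proportion of order [A] of all of them. *)
Lemma branches_suffice (A x L n k r h M : R) :
  0 < A -> 64 * A < 1 -> 2 <= L -> 0 < k -> k <= x -> (1 - 32 * A) * x <= k ->
  96 <= A * x -> k ^+ 2 * L <= 4 * n -> 0 <= r -> A * n <= k * r ->
  h <= (1 - 64 * A) * (x * L) + 1 -> M <= A ^+ 2 * (k * L) ^+ 2 ->
  r * h + 4 * M <= r * (k * L).
Proof.
move=> A0 A1 L2 k0 kx xk Ax kn r0 rn hh MM.
have x0 : 0 <= x := le_trans (ltW k0) kx.
have L0 : 0 <= L by lra.
have xL : x <= x * L by rewrite ler_peMr //; lra.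
have AxL : A * x <= A * (x * L) by rewrite (ler_pM2l A0).
have step1 : r * h <= r * ((1 - 48 * A) * (x * L)) by apply: ler_wpM2l => //; lra.
have step2 : r * ((1 - 32 * A) * (x * L)) <= r * (k * L).
  by apply: ler_wpM2l => //; rewrite mulrA; apply: ler_wpM2r.
(* Replacing [k] by its lower bound leaves a margin [16 * A] for the discarded vertices. *)
suff : 4 * (A ^+ 2 * (k * L) ^+ 2) <= r * (16 * A * (x * L)) by lra.
rewrite -(ler_pM2l k0).
have -> : k * (r * (16 * A * (x * L))) = k * r * (16 * A * (x * L)) by ring.
have pos : 0 <= 16 * A * (x * L) by rewrite !mulr_ge0 // ltW.
apply: le_trans (ler_wpM2r pos rn).
have -> : A * n * (16 * A * (x * L)) = 4 * A ^+ 2 * (x * L * (4 * n)) by ring.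
have -> : k * (4 * (A ^+ 2 * (k * L) ^+ 2)) = 4 * A ^+ 2 * (k * L * (k ^+ 2 * L)) by ring.
apply: ler_wpM2l; first by rewrite mulr_ge0 // exprn_ge0 // ltW.
apply: ler_pM => //; first by rewrite mulr_ge0 // ltW.
- by rewrite mulr_ge0 // exprn_ge0 // ltW.
- by rewrite ler_wpM2r.
Qed.

(** Every quantity is tuned by the single small parameter [A = delta / 64]: the number [k] of branch fibers falls short of [x = hajos_scale R n l / l] by a proportion between [16 * A] and [32 * A], the connectors take a proportion [1 - 8 * A] of the fibers, and the reserved fibers at most [4 * A].  All requirements hold once [x] exceeds a constant [2 * Q]. *)
Lemma lower_tail (delta eta : R) : 0 < delta -> delta < 1 -> 0 < eta ->
  exists K0 : nat, forall n l, (2 <= l)%N -> (K0 * l <= n)%N ->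
    prob R (fun s : {ffun 'I_n * 'I_n -> {perm 'I_l}} =>
      (hajos (lift_of s))%:R < (1 - delta) * hajos_scale R n l) <= eta.
Proof.
move=> d0 d1 eta0.
have [A dA] : exists A : R, delta = 64 * A by exists (delta / 64); field.
have A0 : 0 < A by lra.
have A1 : 64 * A < 1 by lra.
rewrite {d0 d1 delta}dA.
pose mu := A ^+ 2 / 2; pose theta := 8 * A.
have mu0 : 0 < mu by rewrite divr_gt0 // exprn_gt0.
have theta0 : 0 < theta by rewrite mulr_gt0.
have [Q [Qmu QA Q1 Q2 Q3]] : exists Q : R, [/\ 2 / mu <= Q, 48 / A <= Q,
   32 / (mu ^+ 2 * theta * eta) <= Q,
   (4 / A) ^+ 2 * 27 / (eta / 2) * (4 / A) <= Q & 1 <= Q].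
  have a1 : 0 <= 2 / mu by rewrite divr_ge0 // ltW.
  have a2 : 0 <= 48 / A by rewrite divr_ge0 // ltW.
  have a3 : 0 <= 32 / (mu ^+ 2 * theta * eta).
    by rewrite divr_ge0 // ltW // !mulr_gt0 // exprn_gt0.
  have a4 : 0 <= (4 / A) ^+ 2 * 27 / (eta / 2) * (4 / A).
    have q1 : 0 <= eta / 2 by rewrite divr_ge0 // ltW.
    have q2 : 0 <= 4 / A by rewrite divr_ge0 // ltW.
    apply: mulr_ge0 => //; apply: divr_ge0 => //; apply: mulr_ge0 => //; exact: exprn_ge0.
  exists (2 / mu + 48 / A + 32 / (mu ^+ 2 * theta * eta) +
     (4 / A) ^+ 2 * 27 / (eta / 2) * (4 / A) + 1).
  split; lra.
rewrite (ler_pdivrMr _ _ mu0) in Qmu; rewrite (ler_pdivrMr _ _ A0) in QA.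
exists (Num.truncn (4 * Q ^+ 2)).+1 => n l l2 nl.
set S := hajos_scale R n l; have S2 := hajos_scale_sqr R n l2; rewrite -/S in S2.
have S_ge0 : 0 <= S by rewrite sqrtr_ge0.
have L2 : 2 <= l%:R :> R by rewrite ler_nat.
have L0 : 0 < l%:R :> R by lra.
have LE : l.-1%:R = l%:R - 1 :> R by rewrite -[in RHS](prednK (ltnW l2)) mulrSr addrK.
pose x := S / l%:R.
have x2 : x ^+ 2 * (l%:R - 1) = 2 * n%:R.
  rewrite /x expr_div_n; apply: (mulIf (lt0r_neq0 L0)); rewrite -S2; field; by rewrite gt_eqF.
have SE : S = x * l%:R by rewrite /x divfK // gt_eqF.
have nL : 4 * Q ^+ 2 * l%:R <= n%:R.
  apply: (@le_trans _ _ ((Num.truncn (4 * Q ^+ 2)).+1 * l)%:R); last by rewrite ler_nat.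
  by rewrite natrM; apply: ler_wpM2r; [exact: ltW | exact/ltW/truncnS_gt].
have x_ge0 : 0 <= x by rewrite divr_ge0 // ltW.
clearbody x S.
have Qx : 2 * Q <= x.
  have L10 : 0 < l%:R - 1 :> R by lra.
  have : (2 * Q) ^+ 2 <= x ^+ 2.
    rewrite exprMn -(ler_pM2r L10) x2.
    have : 0 <= Q ^+ 2 by rewrite sqr_ge0.
    nra.
  by rewrite ler_pXn2r // nnegrE; lra.
have nx : x * Q <= n%:R.
  have : x ^+ 2 <= 2 * n%:R by rewrite -x2 ler_peMr ?sqr_ge0 //; lra.
  nra.
have xAn : 48 * x <= A * n%:R by nra.
have x2l : x ^+ 2 * l%:R <= 4 * n%:R.
  have : 0 <= x ^+ 2 by rewrite sqr_ge0.
  nra.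
have Ax : 96 <= A * x by nra.
have Q0 : 0 < Q by lra.
have n0 : 0 < n%:R :> R by apply: lt_le_trans nx; rewrite mulr_gt0 //; lra.
have An1 : 1 <= A * n%:R by lra.
have [||k [/ltW kx2 kx1]] := @exists_nat_between ((1 - 32 * A) * x) ((1 - 16 * A) * x).
- by rewrite mulr_ge0 //; lra.
- by lra.
have kx : k%:R <= x by nra.
have kQ : Q <= k%:R by nra.
have k_gt0 : (0 < k)%N by rewrite -(ltr_nat R); lra.
have K0 : 0 < k%:R :> R by rewrite ltr0n.
have k2l : k%:R ^+ 2 * l%:R <= 4 * n%:R :> R.
  apply: le_trans x2l; rewrite ler_wpM2r ?(ltW L0) //.
  by apply: lerXn2r; rewrite ?nnegrE ?(ltW K0).
have kAn : k%:R <= A * n%:R by lra.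
have [||D [/ltW D1 D2]] := @exists_nat_between ((1 - 8 * A) * n%:R) ((1 - 8 * A) * n%:R + 1).
- by rewrite mulr_ge0 //; lra.
- by [].
have [||r [/ltW r2 r1]] := @exists_nat_between (A * n%:R / k%:R) (2 * (A * n%:R) / k%:R).
- by rewrite divr_ge0 ?(ltW K0) // mulr_ge0 // ltW.
- by rewrite (ler_pdivlMr _ _ K0) mulrDl divfK ?gt_eqF //; lra.
rewrite (ler_pdivlMr _ _ K0) mulrC in r1; rewrite (ler_pdivrMr _ _ K0) [leRHS]mulrC in r2.
have kl0 : 0 <= (k * l)%:R ^+ 2 :> R by rewrite exprn_ge0.
have muk : 2 <= mu * k%:R by apply: (le_trans Qmu); rewrite mulrC (ler_wpM2l (ltW mu0)).

have muk2 : 1 <= mu * (k * l)%:R ^+ 2.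
  have kkl : k%:R <= (k * l)%:R ^+ 2 :> R.
    rewrite -natrX ler_nat expnS expn1 -mulnA leq_pmulr // muln_gt0 (ltnW l2) //=.
    by rewrite muln_gt0 k_gt0 (ltnW l2).
  apply: le_trans (ler_wpM2l (ltW mu0) kkl); lra.
have [||M [/ltW M1 M2]] := @exists_nat_between (mu * (k * l)%:R ^+ 2) (2 * (mu * (k * l)%:R ^+ 2)).
- by rewrite mulr_ge0 // ltW.
- by lra.
have [||h [h1 h2]] := @exists_nat_between ((1 - 64 * A) * S) ((1 - 64 * A) * S + 1).
- by rewrite mulr_ge0 //; lra.
- by [].
have D_gt0 : (0 < D)%N.
  rewrite -(ltr_nat R); apply: lt_le_trans D1; rewrite mulr_gt0 //; lra.
have r_gt0 : (0 < r)%N.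
  by rewrite lt0n; apply: contraTneq r2 => ->; rewrite mulr0 -ltNge; lra.
have fits : (k + D + 2 * (k * r) <= n)%N.
  by rewrite -(ler_nat R) !natrD !natrM; lra.
have enough : (k * (k * l.-1))%:R <= 2 * (1 - theta) * D%:R.
  by rewrite !natrM LE; apply: connectors_suffice kx1 x2 D1 => //; exact: ltW.
have hM : (r * h + 4 * M <= r * (k * l))%N.
  rewrite -(ler_nat R) natrD !natrM; rewrite SE in h2.
  apply: branches_suffice kx kx2 Ax k2l _ r2 h2 _ => //.
  apply: le_trans M2 _; rewrite natrM /mu le_eqVlt; apply/orP; left; apply/eqP; by field.
apply: (@le_trans _ _ (prob R (fun s : {ffun 'I_n * 'I_n -> {perm 'I_l}} =>
   (hajos (lift_of s) < h)%N))).
  by apply: le_prob => s hs; rewrite -(ltr_nat R); apply: lt_trans hs h1.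
have := prob_hajos_lt (ltnW l2) k_gt0 D_gt0 r_gt0 fits mu0 muk M1 theta0 enough hM.
move=> /le_trans; apply.
have -> : eta = eta / 2 + eta / 2 by field.
apply: lerD.
  have q1 : 0 < mu ^+ 2 * theta * eta by rewrite !mulr_gt0 // exprn_gt0.
  have q2 : 0 < mu ^+ 2 * k%:R * theta by rewrite !mulr_gt0 // exprn_gt0.
  rewrite (ler_pdivrMr _ _ q1) in Q1; rewrite (ler_pdivrMr _ _ q2).
  have : Q * (mu ^+ 2 * theta * eta) <= k%:R * (mu ^+ 2 * theta * eta) by rewrite (ler_pM2r q1).
  have -> : k%:R * (mu ^+ 2 * theta * eta) = 2 * (eta / 2 * (mu ^+ 2 * k%:R * theta)) by field.
  lra.
have A40 : 0 < A / 4 by lra.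
apply: (@bridge_term A) => //.
- by rewrite divr_gt0.
- exact: ltnW l2.
- rewrite -(ler_pM2l K0); apply: le_trans r2.
  have -> : k%:R * (A * (k * l)%:R / 4) = A * ((k%:R ^+ 2 * l%:R) / 4) by rewrite natrM; field.
  by rewrite (ler_pM2l A0); lra.
- by apply: (le_trans QA); rewrite mulrC (ler_pM2l A0).
- have q : 0 < 4 / A by rewrite divr_gt0.
  move: Q2; rewrite -(ler_pdivlMr _ _ q) => /le_trans; apply.
  have -> : Q / (4 / A) = A * Q / 4 by field; rewrite gt_eqF.
  have : A * Q <= A * k%:R by rewrite (ler_pM2l A0).
  lra.
Qed.

End LowerAsymptotics.

Local Open Scope classical_set_scope.
Local Open Scope ring_scope.

Lemma near_ratio_le (R : realType) (l : nat -> nat) (K : nat) :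
  (fun n : nat => (l n)%:R / n%:R : R) @ \oo --> (0 : R) ->
  \forall n \near \oo, (K * l n <= n)%N.
Proof.
move=> /cvgrPdist_lt/(_ (K.+1%:R^-1)) lim.
near=> n.
have n0 : (0 < n)%N by near: n; exact: nbhs_infty_gt.
have : `|0 - (l n)%:R / n%:R : R| < K.+1%:R^-1.
  by near: n; apply: lim; rewrite invr_gt0 ltr0n.
rewrite sub0r normrN ger0_norm ?divr_ge0 // ltr_pdivrMr ?ltr0n //.
rewrite mulrC ltr_pdivlMr ?ltr0n // -natrM ltr_nat => /ltnW.
by apply: leq_trans; rewrite mulnC leq_mul2l leqnSn orbT.
Unshelve. all: by end_near. Qed.

Theorem theorem1p4 (R : realType) (l : nat -> nat)
  (hl2 : forall n : nat, (2 <= l n)%N)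
  (hln : (fun n : nat => (l n)%:R / n%:R : R) @ \oo --> (0 : R))
  (delta : R) (hdelta : 0 < delta) :
  (fun n : nat =>
     lift_prob R (complete_graph n)
       (fun G : {set {set 'I_n * 'I_(l n)}} =>
          (1 - delta) * hajos_scale R n (l n) <= (hajos G)%:R
            <= (1 + delta) * hajos_scale R n (l n)))
    @ \oo --> (1 : R).
Proof.
apply/cvgrPdist_le => e e0.
have e20 : 0 < e / 2 by rewrite divr_gt0.
(* The lower tail is applied to a parameter below [1]; for a larger [delta] the lower bound is not positive. *)
pose d := Num.min delta (1 / 2).
have d0 : 0 < d by rewrite lt_min hdelta /=; lra.
have d1 : d < 1 by rewrite gt_min; apply/orP; right; lra.
have dd : d <= delta by rewrite ge_min lexx.
have [Ku upper] := upper_tail hdelta e20.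
have [Kl lower] := lower_tail d0 d1 e20.
near=> n.
have fitu : (Ku * l n <= n)%N by near: n; exact: near_ratio_le hln.
have fitl : (Kl * l n <= n)%N by near: n; exact: near_ratio_le hln.
rewrite lift_probE probC; last exact: card_matchings_gt0.
set p := prob R _; suff : p <= e.
  have -> : 1 - (1 - p) = p :> R by ring.
  by rewrite ger0_norm // prob_ge0.
rewrite {}/p.
have -> : e = e / 2 + e / 2 by field.
apply: le_trans (lerD (lower n (l n) (hl2 n) fitl) (upper n (l n) (hl2 n) fitu)).
apply: le_trans (probU _ _ _); apply: le_prob => s /=.
rewrite negb_and -!ltNge => /orP[lt|->]; last by rewrite orbT.
apply/orP; left; apply: lt_le_trans lt _; apply: ler_wpM2r; first exact: sqrtr_ge0.
by rewrite lerD2l lerN2.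
Unshelve. all: by end_near. Qed.
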